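(* Let $d\ge3$ and let $p,q\in(1,\infty]$ satisfy $\frac1p+\frac1q<\frac2{d-1}$. Then there exists $c=c(d,p,q)\in[1,\infty)$ such that the following holds for every $\omega\in\Omega=(0,\infty)^{\mathbb B^d}$: every $u:\mathbb Z^d\to\mathbb R$ with $\nabla^*(\omega\nabla u)=0$ in $\mathbb Z^d$ satisfies, for every $y\in\mathbb Z^d$ and every $n\in\mathbb N$, $$\max_{x\in B(y,n)}|u(x)|\le c\,\Lambda^\omega(B(y,2n))^{p'\frac{\delta+1}{\delta}}\,\|u\|_{\underline L^1(B(y,2n))},$$ where $\delta:=\frac1{d-1}-\frac1{2p}-\frac1{2q}>0$, $p':=\frac p{p-1}$, and for every bounded $S\subset\mathbb Z^d$ $$\Lambda^\omega(S):=\|\omega\|_{\underline L^p(S)}\,\|\omega^{-1}\|_{\underline L^q(S)}.$$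
   Context: $\mathbb N=\{1,2,\dots\}$. $\mathbb B^d:=\{\{x,y\}:x,y\in\mathbb Z^d,|x-y|=1\}$ is the set of nonoriented nearest-neighbor bonds. Each bond is written $\mathrm e=\{\underline{\mathrm e},\overline{\mathrm e}\}$ with $\overline{\mathrm e}-\underline{\mathrm e}\in\{e_1,\dots,e_d\}$ (standard basis). $B(y,n):=y+([-n,n]\cap\mathbb Z)^d$. For $f:\mathbb Z^d\to\mathbb R$, $\nabla f:\mathbb B^d\to\mathbb R$ is $\nabla f(\mathrm e):=f(\overline{\mathrm e})-f(\underline{\mathrm e})$. For $F:\mathbb B^d\to\mathbb R$, $\nabla^*F(x):=\sum_{i=1}^d\big(F(\{x-e_i,x\})-F(\{x,x+e_i\})\big)$. Thus $-\nabla^*(\omega\nabla u)(x)=\sum_{y:\{x,y\}\in\mathbb B^d}\omega(\{x,y\})(u(y)-u(x))$. For finite $S\subset\mathbb Z^d$ let $S_{\mathbb B^d}$ be the set of bonds with both end-points in $S$. For $r\in(0,\infty)$, $f:\mathbb Z^d\to\mathbb R$ and $F:\mathbb B^d\to\mathbb R$: $\|f\|_{\underline L^r(S)}:=\big(\frac1{|S|}\sum_{x\in S}|f(x)|^r\big)^{1/r}$ and $\|F\|_{\underline L^r(S)}:=\big(\frac1{|S_{\mathbb B^d}|}\sum_{\mathrm e\in S_{\mathbb B^d}}|F(\mathrm e)|^r\big)^{1/r}$; for $r=\infty$ these are the suprema over $S$, resp. $S_{\mathbb B^d}$. $\omega$ and $\omega^{-1}$ are functions on bonds. Conventions: $1/\infty=0$,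 and $p'=1$ if $p=\infty$. *)

(* Defs.v *)
From HB Require Import structures.
From mathcomp Require Import all_boot all_order all_algebra.
From mathcomp Require Import finmap.
From mathcomp Require Import reals constructive_ereal ereal exp.

Set Implicit Arguments.
Unset Strict Implicit.
Unset Printing Implicit Defensive.

Import Order.TTheory GRing.Theory Num.Theory.

Local Open Scope fset_scope.
Local Open Scope ring_scope.

Notation site d := 'rV[int]_d.

(* A nonoriented nearest-neighbor bond is encoded by its lower end-point x and
   its direction i, i.e. (x, i) stands for {x, x + e_i}; [bond_ends_inj] and
   [bond_endsP] below show that this is a bijection onto the pairs {x, y}
   of sites at Euclidean distance 1. *)
Notation bond d := (site d * 'I_d)%type.

Definition unit_vec d (i : 'I_d) : site d := delta_mx 0 i.

Definition lower d (e : bond d) : site d := e.1.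
Definition upper d (e : bond d) : site d := e.1 + unit_vec e.2.

Definition bond_ends d (e : bond d) : {fset site d} := [fset lower e; upper e].

Lemma bond_ends_inj d : injective (@bond_ends d).
Proof.
move=> [x i] [y j] /fsetP E; rewrite /bond_ends /lower /upper /unit_vec /= in E.
have unit_inj k l : delta_mx 0 k = delta_mx 0 l :> site d -> k = l.
  move=> /rowP/(_ k); rewrite !mxE !eqxx /=.
  by case: (k =P l).
have unit_neq0 k (z : site d) : z + delta_mx 0 k <> z.
  rewrite -[X in _ = X]addr0 => /addrI/rowP/(_ k).
  by rewrite !mxE !eqxx.
have [] : x = y \/ x = y + delta_mx 0 j.
- by move: (E x); rewrite !inE eqxx /= => /esym/orP[]/eqP->; [left|right].
- move=> xy; subst y.
  move: (E (x + delta_mx 0 i)); rewrite !inE eqxx orbT => /esym/orP[]/eqP.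
    by move=> /unit_neq0.
  by move=> /addrI/unit_inj ->.
- move=> xy; subst x.
  move: (E (y + delta_mx 0 j + delta_mx 0 i)).
  rewrite !inE eqxx orbT => /esym/orP[]/eqP.
    rewrite -addrA -[X in _ = X]addr0 => /addrI/rowP/(_ i).
    by rewrite !mxE !eqxx /=; case: (i == j).
  by move=> /unit_neq0.
Qed.

Lemma bond_endsP d (x y : site d) :
  (\sum_i (x 0 i - y 0 i) ^+ 2 = 1) <->
  (exists e : bond d, bond_ends e = [fset x; y]).
Proof.
split=> [xy1|[[z i] /fsetP E]]; last first.
  rewrite /bond_ends /lower /upper /unit_vec /= in E.
  have sum1 : \sum_k (z 0 k - (z + delta_mx 0 i : site d) 0 k) ^+ 2 = 1.
    rewrite (bigD1 i) //= big1 => [|k /negbTE ki].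
      by rewrite !mxE !eqxx /= opprD addNKr.
    by rewrite !mxE ki andbF addr0 subrr expr0n.
  have zNe : z != z + delta_mx 0 i.
    apply/eqP; rewrite -[X in X = _]addr0 => /addrI/rowP/(_ i).
    by rewrite !mxE !eqxx.
  have Ez := E z; have Ee := E (z + delta_mx 0 i).
  rewrite !inE eqxx /= in Ez; rewrite !inE eqxx orbT in Ee.
  move: Ez => /esym/orP[]/eqP zx; move: Ee => /esym/orP[]/eqP ey.
  - by move: zNe; rewrite ey zx eqxx.
  - by rewrite -zx -ey.
  - rewrite -zx -ey -[RHS]sum1; apply: eq_bigr => k _.
    by rewrite -sqrrN opprB.
  - by move: zNe; rewrite ey zx eqxx.
pose v i := x 0 i - y 0 i.
have [i vi0] : exists i, v i != 0.
  apply/existsP; apply: contraPT xy1; rewrite negb_exists => /forallP v_eq0.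
  by rewrite big1 // => i _; move: (v_eq0 i); rewrite negbK -/(v i) => /eqP ->.
have vi1 : 1 <= v i ^+ 2 by rewrite -gtz0_ge1 lt0r sqrf_eq0 vi0 sqr_ge0.
have restge0 : 0 <= \sum_(k | k != i) v k ^+ 2.
  by apply: sumr_ge0 => k _; exact: sqr_ge0.
move: xy1; rewrite (bigD1 i) //= -/(v i) => xy1.
have vi1' : v i ^+ 2 = 1.
  by apply/eqP; rewrite eq_le vi1 andbT -xy1 lerDl.
have vk0 k : k != i -> v k = 0.
  move=> ki; have: \sum_(k | k != i) v k ^+ 2 = 0.
    by apply: (addrI (v i ^+ 2)); rewrite xy1 addr0.
  move=> /eqP; rewrite psumr_eq0; last by move=> ? _; exact: sqr_ge0.
  by move=> /allP/(_ k (mem_index_enum _)); rewrite ki sqrf_eq0 => /eqP.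
move/eqP: vi1'; rewrite sqrf_eq1 => /orP[]/eqP vi.
- exists (y, i); rewrite /bond_ends /lower /upper /unit_vec /=.
  suff -> : y + delta_mx 0 i = x by rewrite fsetUC.
  apply/rowP => k; rewrite !mxE eqxx /=; have [->|ki] := eqVneq k i.
    by rewrite mulr1n -vi addrC subrK.
  by rewrite addr0; apply/eqP; rewrite eq_sym -subr_eq0; apply/eqP/vk0.
- exists (x, i); rewrite /bond_ends /lower /upper /unit_vec /=.
  suff -> : x + delta_mx 0 i = y by [].
  apply/rowP => k; rewrite !mxE eqxx /=; have [->|ki] := eqVneq k i.
    apply/eqP; rewrite -[1%:R]/(1 : int) -[1]opprK -vi opprB addrC subrK.
    by [].
  by rewrite addr0; apply/eqP; rewrite -subr_eq0; apply/eqP/vk0.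
Qed.

Definition box d (y : site d) (n : nat) : {fset site d} :=
  [fset y + \row_i ((k i : nat)%:Z - n%:Z)
    | k : {ffun 'I_d -> 'I_(n.*2.+1)} in predT].

Lemma in_box d (y x : site d) n :
  (x \in box y n) = [forall i, `|x 0 i - y 0 i| <= n%:Z].
Proof.
apply/imfsetP/forallP => /= [[k _ ->] i|xy].
  rewrite !mxE addrAC subrr add0r ler_norml lerBrDr addNr lerBlDr -PoszD addnn.
  by rewrite !lez_nat leq0n -ltnS ltn_ord.
have kP i : (absz (x 0 i - y 0 i + n%:Z)%R < n.*2.+1)%N.
  move: (xy i); rewrite ler_norml ltnS -lez_nat => /andP[lo hi].
  rewrite gez0_abs; last by rewrite -(opprK n%:Z) subr_ge0.
  by rewrite -addnn PoszD lerD2r.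
exists [ffun i => Ordinal (kP i)] => //; apply/rowP => i; rewrite !mxE ffunE /=.
rewrite gez0_abs; last first.
  by move: (xy i); rewrite ler_norml => /andP[+ _]; rewrite -subr_ge0 opprK.
by rewrite addrK addrC subrK.
Qed.

Definition bonds_in d (S : {fset site d}) : {fset bond d} :=
  [fset e in S `*` [fset i in 'I_d] | upper e \in S].

Lemma in_bonds_in d (S : {fset site d}) (e : bond d) :
  (e \in bonds_in S) = (lower e \in S) && (upper e \in S).
Proof. by rewrite !inE /= andbT. Qed.

Definition nabla (R : realType) d (f : site d -> R) (e : bond d) : R :=
  f (upper e) - f (lower e).

Definition nabla_star (R : realType) d (F : bond d -> R) (x : site d) : R :=
  \sum_(i < d) (F (x - unit_vec i, i) - F (x, i)).

(* The value at -oo, and at finite r <= 0, is irrelevant. *)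
Definition avg_norm (R : realType) (K : choiceType) (r : \bar R)
    (f : K -> R) (A : {fset K}) : R :=
  match r with
  | EFin s => ((#|` A|%:R)^-1 * \sum_(a <- A) `|f a| `^ s) `^ s^-1
  | +oo%E => \big[Num.max/0]_(a <- A) `|f a|
  | -oo%E => 0
  end.

Definition site_norm (R : realType) d (r : \bar R) (f : site d -> R)
    (S : {fset site d}) : R := avg_norm r f S.

Definition bond_norm (R : realType) d (r : \bar R) (F : bond d -> R)
    (S : {fset site d}) : R := avg_norm r F (bonds_in S).

Definition Lambda (R : realType) d (p q : \bar R) (omega : bond d -> R)
    (S : {fset site d}) : R :=
  bond_norm p omega S * bond_norm q (fun e => (omega e)^-1) S.

(* 1/r, with 1/oo = 0; real-valued for r > 0. *)
Definition recip (R : realType) (r : \bar R) : R := fine (r^-1)%E.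

(* The Hoelder conjugate p' = p / (p - 1), with the convention p' = 1 at oo. *)
Definition dual_exp (R : realType) (p : \bar R) : R :=
  match p with EFin s => s / (s - 1) | _ => 1 end.

(* 1/(2p) + 1/(2q) is written (1/p)/2 + (1/q)/2. *)
Definition delta (R : realType) (d : nat) (p q : \bar R) : R :=
  (d%:R - 1)^-1 - recip p / 2 - recip q / 2.

(* Main.v *)
Require Import Defs.
From mathcomp Require Import all_boot all_order all_algebra.
From mathcomp Require Import finmap.
From mathcomp Require Import reals constructive_ereal ereal exp.
From mathcomp Require Import ring lra zify.
Set Implicit Arguments.
Unset Strict Implicit.
Unset Printing Implicit Defensive.

Import Order.TTheory GRing.Theory Num.Theory.
Local Open Scope ring_scope.

(** Harmonic functions for degenerate conductances are locally bounded as soon as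
    1/p + 1/q < 2/(d-1), although the usual De Giorgi-Moser iteration needs
    1/p + 1/q < 2/d.  One dimension is gained by choosing the cutoff function well.

    Let v be the part of u above a level k, and eta a radial cutoff (radial with
    respect to the sup norm, whose spheres are boundaries of boxes).  Testing the
    equation against eta^2 v bounds the energy of eta v by the sum of
    omega v v' (nabla eta)^2 ([caccioppoli]), to which only the bonds between
    two consecutive radii contribute on which eta varies.  The sphere of such a
    radius consists of 2d faces, which lie on hyperplanes of dimension d-1.  By
    Markov's inequality at least a third of the radii in [N, 2N) carries at most
    three times the average of omega^p and of the t-th power of the gradient
    ([good_radii]), and eta is made to decrease on these radii only.  On each
    hyperplane the Sobolev inequality in dimension d-1 then bounds v
    ([sobolev_hyperplane]).  As it is applied to functions with compact support it
    has no lower-order terms; it follows from the Loomis-Whitney inequality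
    ([loomis_whitney]).

    Here t = 2q/(q+1) is the exponent for which Hoelder's inequality controls the
    t-norm of the gradient by the energy and the q-norm of 1/omega
    ([gradient_norm_le]).  The Sobolev exponent s of t in dimension d-1 satisfies
    1/(2p') - 1/s = delta > 0, where p' is the dual exponent of p.  If a level is
    raised from k to k+h, the power 2p' of the new excess is at most h^(2p'-s) times
    the power s of the old one ([level_gain]), and so the energy at the next scale
    and level is at most a constant times the power gain = s/(2p') > 1 of the energy
    at the previous ones ([energy_step]).  Over the dyadic radii 2^J, 2^(J-1), ..., 1
    this superlinear recursion decays fast enough to bound u at the centre by the
    2p'-mean of |u| on the box of radius 2^J, with the power
    gain/(2(gain-1)) of Lambda ([center_bound]).

    To pass from the 2p'-mean to the mean of |u|, the point x0 is taken that
    maximizes |u(x)| dist(x)^K, with dist the distance to the boundary of B(y,2n).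
    Around x0 the function |u| is at most 2^K |u(x0)|, and this bound absorbs the
    excess power of |u| ([center_bound_mean], [weighted_bound]).  The result is the
    estimate with the exponent 1/(2 delta) on Lambda ([local_boundedness]).  The
    exponent of the theorem is larger than 1/delta and Lambda is at least 1, so that
    infinite exponents p and q can be replaced by finite ones for which delta drops
    by at most a factor 2 ([finite_exponent_exists]). *)

(** * Powers of real numbers and finite sums *)

Section RealPowers.
Variable R : realType.
Implicit Types a b p q r : R.

Lemma powRK a p : 0 <= a -> p != 0 -> (a `^ p) `^ p^-1 = a.
Proof. by move=> a0 p0; rewrite -powRrM divff// powRr1. Qed.

Lemma powRVK a p : 0 <= a -> p != 0 -> (a `^ p^-1) `^ p = a.
Proof. by move=> a0 p0; rewrite -powRrM mulVf// powRr1. Qed.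

Lemma ler_powRl r a b : 0 <= r -> 0 <= a -> a <= b -> a `^ r <= b `^ r.
Proof.
move=> r0 a0 ab; apply: ge0_ler_powR; rewrite ?nnegrE //.
exact: le_trans ab.
Qed.

Lemma powRV a p : 0 <= a -> a^-1 `^ p = (a `^ p)^-1.
Proof. by move=> a0; rewrite -powR_inv1// -powRrM mulN1r powRN. Qed.

Lemma powR_div a b p : 0 <= a -> 0 <= b -> (a / b) `^ p = a `^ p / b `^ p.
Proof. by move=> a0 b0; rewrite powRM ?invr_ge0// powRV. Qed.

Lemma powR_ge1 a p : 1 <= a -> 0 <= p -> 1 <= a `^ p.
Proof. by move=> a1 p0; have := ler_powR a1 p0; rewrite powRr0. Qed.

(** Young's inequality for the two factors divided by their norms. *)
Lemma holder_sum (T : Type) (l : seq T) (P : pred T) (f g : T -> R) p q :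
  0 < p -> 0 < q -> p^-1 + q^-1 = 1 ->
  (forall i, 0 <= f i) -> (forall i, 0 <= g i) ->
  \sum_(i <- l | P i) f i * g i <=
    (\sum_(i <- l | P i) f i `^ p) `^ p^-1 * (\sum_(i <- l | P i) g i `^ q) `^ q^-1.
Proof.
move=> p0 q0 pq f0 g0.
set F := \sum_(i <- l | P i) f i `^ p; set G := \sum_(i <- l | P i) g i `^ q.
have FE : \sum_(i <- l | P i) f i `^ p = F by [].
have GE : \sum_(i <- l | P i) g i `^ q = G by [].
have zero (h : T -> R) (r : R) : 0 < r -> (forall i, 0 <= h i) ->
    \sum_(i <- l | P i) h i `^ r = 0 ->
    forall k : T -> R, (forall i, 0 <= k i) ->
    \sum_(i <- l | P i) h i * k i <= 0.
  move=> r0 h0; elim: l {F G FE GE} => [|x l IH]; first by move=> _ k _; rewrite big_nil.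
  rewrite big_cons => + k k0; rewrite big_cons; case: ifP => [Px /eqP|_ /IH]; last exact.
  rewrite paddr_eq0 ?powR_ge0 ?sumr_ge0// => [|i _]; last exact: powR_ge0.
  rewrite powR_eq0 (lt0r_neq0 r0) andbT => /andP[/eqP hx /eqP h_eq0].
  by rewrite hx mul0r add0r IH.
have F0 : 0 <= F by apply: sumr_ge0 => i _; exact: powR_ge0.
have G0 : 0 <= G by apply: sumr_ge0 => i _; exact: powR_ge0.
clearbody F G.
have [F_eq0|Fn0] := eqVneq F 0.
  apply: (@le_trans _ _ 0); last by rewrite mulr_ge0 ?powR_ge0.
  by apply: (zero f p) => //; rewrite FE.
have [G_eq0|Gn0] := eqVneq G 0.
  apply: (@le_trans _ _ 0); last by rewrite mulr_ge0 ?powR_ge0.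
  under eq_bigr do rewrite mulrC.
  by apply: (zero g q) => //; rewrite GE.
have Fp : 0 < F by rewrite lt0r Fn0.
have Gp : 0 < G by rewrite lt0r Gn0.
have Fp' : 0 < F `^ p^-1 by exact: powR_gt0.
have Gp' : 0 < G `^ q^-1 by exact: powR_gt0.
set FG := F `^ p^-1 * G `^ q^-1.
have FG0 : 0 < FG by exact: mulr_gt0.
suff : FG^-1 * (\sum_(i <- l | P i) f i * g i) <= 1 by rewrite ler_pdivrMl// mulr1.
rewrite -[X in _ <= X]pq mulr_sumr.
have -> : p^-1 + q^-1 = \sum_(i <- l | P i)
    ((f i / F `^ p^-1) `^ p / p + (g i / G `^ q^-1) `^ q / q).
  rewrite big_split /= -!mulr_suml; congr (_ + _).
    under eq_bigr do rewrite powR_div ?powR_ge0// (powRVK F0 (lt0r_neq0 p0)).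
    by rewrite -mulr_suml FE divff// mul1r.
  under eq_bigr do rewrite powR_div ?powR_ge0// (powRVK G0 (lt0r_neq0 q0)).
  by rewrite -mulr_suml GE divff// mul1r.
apply: ler_sum => i _.
have -> : FG^-1 * (f i * g i) =
   (f i / F `^ p^-1) * (g i / G `^ q^-1).
  by rewrite /FG invfM; ring.
by apply: conjugate_powR => //; rewrite ?divr_ge0 ?powR_ge0.
Qed.

Lemma prod_powR (J : Type) (l : seq J) (P : pred J) (E : J -> R) r :
  (forall j, 0 <= E j) ->
  (\prod_(j <- l | P j) E j) `^ r = \prod_(j <- l | P j) E j `^ r.
Proof.
move=> E0; elim: l => [|j l IH]; first by rewrite !big_nil powR1.
by rewrite !big_cons; case: ifP => // Pj; rewrite powRM// ?IH// prodr_ge0.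
Qed.

(** Dividing each [h j] by its sum reduces the claim to the AM-GM inequality,
    summed over the points. *)
Lemma holder_geometric (J : finType) (A : {set J}) (n : nat)
    (T : Type) (l : seq T) (P : pred T) (h : J -> T -> R) :
  #|A| = n -> (0 < n)%N -> (forall j x, 0 <= h j x) ->
  \sum_(x <- l | P x) \prod_(j in A) h j x `^ n%:R^-1 <=
  \prod_(j in A) (\sum_(x <- l | P x) h j x) `^ n%:R^-1.
Proof.
move=> cA n0 h0.
have nR : (n%:R : R) != 0 by rewrite pnatr_eq0 -lt0n.
pose H j := \sum_(x <- l | P x) h j x.
have H0 j : 0 <= H j by apply: sumr_ge0.
have [/existsP[j /andP[jA /eqP Hj]]|] := boolP [exists j, (j \in A) && (H j == 0)].
  suff -> : \sum_(x <- l | P x) \prod_(j0 in A) h j0 x `^ n%:R^-1 = 0.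
    by apply: prodr_ge0 => ? _; exact: powR_ge0.
  move: Hj; rewrite /H; elim: l {H H0} => [|x l IH]; first by rewrite !big_nil.
  rewrite !big_cons; case: ifP => // Px /eqP.
  rewrite paddr_eq0 ?sumr_ge0// => /andP[/eqP hx /eqP hl].
  by rewrite IH// (bigD1 j)//= hx powR0 ?invr_eq0// mul0r addr0.
rewrite negb_exists => /forallP Hn0.
have Hp j : j \in A -> 0 < H j.
  by move=> jA; rewrite lt0r H0 andbT; move: (Hn0 j); rewrite jA.
have PH : 0 < \prod_(j in A) H j `^ n%:R^-1.
  by apply: prodr_gt0 => j jA; apply: powR_gt0; exact: Hp.
rewrite -[X in _ <= X]mul1r -ler_pdivrMr// mulr_suml.
apply: (@le_trans _ _ (\sum_(x <- l | P x) (\sum_(j in A) h j x / H j) / n%:R)).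
  apply: ler_sum => x _.
  rewrite -prodf_div -/(H _).
  rewrite (eq_bigr (fun j => (h j x / H j) `^ n%:R^-1)); last first.
    by move=> j _; rewrite powR_div// H0.
  rewrite -prod_powR; last by move=> j; rewrite divr_ge0.
  have S0 : 0 <= (\sum_(j in A) h j x / H j) / n%:R.
    by rewrite divr_ge0// sumr_ge0// => j _; rewrite divr_ge0.
  have [AGM _] := @leif_AGM R J (mem A) (fun j => h j x / H j)
    (fun j _ => divr_ge0 (h0 j x) (H0 j)).
  rewrite -[X in _ <= X](powRK S0 nR) powR_mulrn//.
  apply: ler_powRl; first by rewrite invr_ge0.
    by apply: prodr_ge0 => j _; rewrite divr_ge0.
  by move: AGM; rewrite cA.
rewrite -mulr_suml exchange_big /=.
under eq_bigr => j jA do rewrite -mulr_suml divff ?lt0r_neq0 ?Hp//.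
by rewrite sumr_const cA divff.
Qed.

(** For [b <= a] the difference is at most [r * a ^ (r - 1) * (a - b)], which is
    Young's inequality for [a ^ (r - 1) * b]; the symmetric form avoids comparing
    [a] and [b]. *)
Lemma powR_sub_le r a b : 1 < r -> 0 <= a -> 0 <= b ->
  `|a `^ r - b `^ r| <= r * (a `^ (r - 1) + b `^ (r - 1)) * `|a - b|.
Proof.
move=> r1.
wlog ba : a b / b <= a => [hw a0 b0|a0 b0].
  have [|/ltW ab] := leP b a; first by move=> ba; exact: hw.
  by rewrite distrC [X in _ * X]distrC [X in r * X]addrC; exact: hw.
have r0 : 0 < r by lra.
rewrite !ger0_norm ?subr_ge0 ?(ler_powRl (ltW r0))//.
have Y : a `^ (r - 1) * b <= a `^ r / (r / (r - 1)) + b `^ r / r.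
  have -> : a `^ r = (a `^ (r - 1)) `^ (r / (r - 1)).
    by rewrite -powRrM; congr (_ `^ _); field; lra.
  apply: conjugate_powR; rewrite ?powR_ge0 ?divr_gt0 ?subr_gt0//.
  by field; lra.
rewrite -(mulr_powRB1 a0 r0) in Y *.
have rA : r * (a `^ (r - 1) * b) <= (r - 1) * (a * a `^ (r - 1)) + b `^ r.
  apply: le_trans (ler_wpM2l (ltW r0) Y) _; rewrite le_eqVlt; apply/orP; left.
  by apply/eqP; field; lra.
have B0 : 0 <= r * b `^ (r - 1) * (a - b) by rewrite !mulr_ge0 ?powR_ge0 ?subr_ge0// ltW.
nra.
Qed.

End RealPowers.

(** * The Loomis-Whitney inequality *)

Section LoomisWhitney.
Variables (R : realType) (I T : finType).
Implicit Types (A B : {set I}) (x y z : {ffun I -> T}) (f : {ffun I -> T} -> R).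

Definition agree A x z := [forall i, (i \notin A) ==> (z i == x i)].

(** The coordinates in [A] are summed out, the others are those of [x].  Keeping
    [x] as an argument makes partial sums over different coordinates functions on
    the same type. *)
Definition psum A f x := \sum_(z | agree A x z) f z.

Lemma agreeP A x z : reflect (forall i, i \notin A -> z i = x i) (agree A x z).
Proof.
apply: (iffP forallP) => [h i iA|h i]; last by apply/implyP => /h ->.
by move: (h i); rewrite iA => /eqP.
Qed.

Lemma agree_mem A x y : agree A x y -> agree A x =1 agree A y.
Proof.
move=> /agreeP xy z; apply/agreeP/agreeP => h i iA; first by rewrite h// xy.
by rewrite h// xy.
Qed.

Lemma psum_agree A f x y : agree A x y -> psum A f x = psum A f y.
Proof. by move=> xy; apply: eq_bigl; exact: agree_mem. Qed.

Lemma psum0 f x : psum set0 f x = f x.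
Proof.
rewrite /psum (big_pred1 x)// => z; apply/agreeP/eqP => [h|-> //].
by apply/ffunP => i; apply: h; rewrite inE.
Qed.

Lemma psum_ge0 A f x : (forall z, 0 <= f z) -> 0 <= psum A f x.
Proof. by move=> f0; apply: sumr_ge0. Qed.

Lemma psumU A B f x : [disjoint A & B] ->
  psum (A :|: B) f x = psum A (psum B f) x.
Proof.
move=> /pred0P dAB.
pose w z := [ffun i => if i \in A then z i else x i].
rewrite /psum (partition_big w (agree A x)) /=; last first.
  by move=> z _; apply/agreeP => i /negbTE iA; rewrite ffunE iA.
apply: eq_bigr => v /agreeP xv; apply: eq_bigl => z.
apply/andP/agreeP => [[/agreeP xz /eqP <-] i iB|vz].
  rewrite ffunE; case: ifPn => // iA.
  by rewrite xz// inE negb_or iA.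
split.
  by apply/agreeP => i; rewrite inE negb_or => /andP[iA iB]; rewrite vz// xv.
apply/eqP/ffunP => i; rewrite ffunE; case: ifPn => iA; last by rewrite xv.
by apply: vz; apply/negP => iB; move: (dAB i); rewrite /= iA iB.
Qed.

(** Summing the product over one more coordinate [j] leaves the factor [j],
    which is already summed along that coordinate, unchanged; the other [n]
    factors are summed by Hoelder's inequality with [n] equal exponents. *)
Lemma loomis_whitney (U B : {set I}) n (g : I -> {ffun I -> T} -> R) x :
  #|U| = n.+1 -> (0 < n)%N -> (forall i z, 0 <= g i z) -> B \subset U ->
  psum B (fun z => \prod_(i in U) psum [set i] (g i) z `^ n%:R^-1) x <=
  \prod_(i in U) psum (i |: B) (g i) x `^ n%:R^-1.
Proof.
move=> cU n0 g0; have [m] := ubnP #|B|; elim: m => // m IH in B x * => Bm BU.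
have [->|[j jB]] := set_0Vmem B.
  by rewrite psum0; under [X in _ <= X]eq_bigr do rewrite setU0.
have jU : j \in U by move/subsetP: BU => /(_ j jB).
set C := B :\ j; have jC : j \notin C by rewrite !inE eqxx.
have BE : B = [set j] :|: C by rewrite setD1K.
have Cm : (#|C| < m)%N by move: Bm; rewrite (cardsD1 j) jB add1n ltnS.
have CU : C \subset U by apply: subset_trans BU; exact: subsetDl.
have dis i : [disjoint [set j] & i |: C] = (j != i).
  by rewrite disjoints1 !inE eqxx /= orbF.
rewrite BE psumU; last by rewrite disjoints1.
apply: (@le_trans _ _ (\sum_(z | agree [set j] x z)
    \prod_(i in U) psum (i |: C) (g i) z `^ n%:R^-1)).
  by apply: ler_sum => z _; exact: IH.
rewrite (eq_bigr (fun z => psum (j |: C) (g j) x `^ n%:R^-1 *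
    \prod_(i in U | i != j) psum (i |: C) (g i) z `^ n%:R^-1)); last first.
  move=> z /agreeP xz; rewrite (bigD1 j)//= -(@psum_agree _ _ x z)//.
  by apply/agreeP => i; rewrite !inE negb_or => /andP[ij _]; rewrite xz// inE.
rewrite -mulr_sumr [X in _ <= X](bigD1 j)//= setUA setUid.
apply: ler_wpM2l; first exact: powR_ge0.
have cUj : #|U :\ j| = n by move: cU; rewrite (cardsD1 j) jU add1n => -[].
have := @holder_geometric R I (U :\ j) n _ (index_enum _) (agree [set j] x)
  (fun i z => psum (i |: C) (g i) z) cUj n0 (fun i z => psum_ge0 _ _ (g0 i)).
have EU h : \prod_(i in U :\ j) h i = \prod_(i in U | i != j) h i :> R.
  by apply: eq_bigl => i; rewrite !inE andbC.
rewrite (eq_bigr _ (fun z _ => EU _)) => /le_trans; apply; rewrite EU le_eqVlt; apply/orP; left; apply/eqP.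
apply: eq_bigr => i /andP[_ ij].
by rewrite setUCA psumU// dis eq_sym.
Qed.

(** The discrete Gagliardo-Nirenberg inequality with exponent 1: a function
    bounded by its line sums in each direction of [U] is bounded by their
    geometric mean, to which the Loomis-Whitney inequality applies. *)
Lemma gagliardo_nirenberg (U : {set I}) n (g : I -> {ffun I -> T} -> R) f x :
  #|U| = n.+1 -> (0 < n)%N -> (forall i z, 0 <= g i z) ->
  (forall z, 0 <= f z) ->
  (forall i z, i \in U -> f z <= psum [set i] (g i) z) ->
  psum U (fun z => f z `^ (n.+1%:R / n%:R)) x <=
  (\sum_(i in U) psum U (g i) x) `^ (n.+1%:R / n%:R).
Proof.
move=> cU n0 g0 f0 fg.
have U0 : U != set0 by rewrite -card_gt0 cU.
have S0 i : 0 <= psum U (g i) x by exact: psum_ge0.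
apply: (@le_trans _ _ (psum U
    (fun z => \prod_(i in U) psum [set i] (g i) z `^ n%:R^-1) x)).
  apply: ler_sum => z _.
  rewrite -[n.+1%:R / n%:R]mulrC powRrM powR_mulrn ?powR_ge0// -cU -prodr_const.
  apply: ler_prod => i iU; rewrite powR_ge0/=.
  by apply: ler_powRl; rewrite ?invr_ge0 ?fg.
apply: (le_trans (loomis_whitney x cU n0 g0 (subxx _))).
rewrite -[n.+1%:R / n%:R]mulrC powRrM powR_mulrn ?powR_ge0// -cU -prodr_const.
apply: ler_prod => i iU; rewrite powR_ge0/=.
apply: ler_powRl; rewrite ?invr_ge0//; first exact: psum_ge0.
rewrite (setUidPr _) ?sub1set// (bigD1 i)//= lerDl.
by apply: sumr_ge0.
Qed.

End LoomisWhitney.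

(** * Sums over boxes of the lattice *)

Section FiniteSums.
Variables (R : realType) (K K' : choiceType).

Lemma ler_fsum (A B : {fset K}) (P Q : pred K) (h : K -> R) :
  (forall x, 0 <= h x) ->
  (forall x, x \in A -> P x -> h x != 0 -> (x \in B) && Q x) ->
  \sum_(x <- A | P x) h x <= \sum_(x <- B | Q x) h x.
Proof.
move=> h0 AB.
rewrite (bigID (fun x => h x != 0)) /= [X in _ + X]big1 ?addr0; last first.
  by move=> x /andP[_]; rewrite negbK => /eqP.
rewrite (@eq_fbigl_cond _ _ _ _ A B _
  (fun x => Q x && [&& x \in A, P x & h x != 0])); last first.
  move=> x; rewrite !inE /=; apply/andP/andP.
    by move=> [xA /andP[Px hx]]; have /andP[-> ->] := AB x xA Px hx; rewrite xA Px hx.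
  by move=> [_ /andP[_ /and3P[-> -> ->]]].
rewrite big_mkcondr; apply: ler_sum => x _.
by case: ifP.
Qed.

Lemma eq_fsum (A B : {fset K}) (h : K -> R) :
  (forall x, h x != 0 -> (x \in A) = (x \in B)) ->
  \sum_(x <- A) h x = \sum_(x <- B) h x.
Proof.
move=> AB.
have H (C : {fset K}) : \sum_(x <- C) h x = \sum_(x <- C | h x != 0) h x.
  rewrite (bigID (fun x => h x != 0)) /= [X in _ + X]big1 ?addr0//.
  by move=> x; rewrite negbK => /eqP.
rewrite H [RHS]H; apply: eq_fbigl_cond => x; rewrite !inE /=.
by apply/andP/andP => -[xA hx]; split=> //; move: (AB x hx); rewrite xA.
Qed.

End FiniteSums.

Lemma ler_fsum_inj (R : realType) (K K' : choiceType) (A : {fset K}) (B : {fset K'})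
  (P : pred K) (Q : pred K') (phi : K -> K') (h : K' -> R) :
  injective phi -> (forall x, 0 <= h x) ->
  (forall x, x \in A -> P x -> h (phi x) != 0 -> (phi x \in B) && Q (phi x)) ->
  \sum_(x <- A | P x) h (phi x) <= \sum_(x <- B | Q x) h x.
Proof.
move=> phi_inj h0 AB; rewrite big_fset_condE.
have -> (C : {fset K}) : \sum_(x <- C) h (phi x) =
    \sum_(z <- [fset phi x | x in C]%fset) h z.
  by rewrite big_imfset//= => ? ? _ _; exact: phi_inj.
apply: ler_fsum => // z /imfsetP[x]; rewrite !inE /= => /andP[xA Px] -> _.
exact: AB.
Qed.

Section Lattice.
Variables (R : realType) (d : nat).
Implicit Types (x y z : site d) (e : bond d) (f : site d -> R).

(** The sup distance, whose balls are the boxes. *)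
Definition rad y x : nat := \max_(i < d) absz (x 0 i - y 0 i)%R.

Lemma mem_box y x n : (x \in box y n) = (rad y x <= n)%N.
Proof.
rewrite in_box; apply/forallP/bigmax_leqP => h i; first by move=> _; move: (h i); rewrite -abszE lez_nat.
by rewrite -abszE lez_nat; exact: h.
Qed.

Lemma unit_vecE (i k : 'I_d) : unit_vec i 0 k = (k == i)%:R.
Proof. by rewrite /unit_vec mxE eqxx. Qed.

Lemma rad_coord y x i : (absz (x 0 i - y 0 i)%R <= rad y x)%N.
Proof. exact: (leq_bigmax i). Qed.

Lemma rad_upper y (x : site d) i : (rad y (x + unit_vec i) <= (rad y x).+1)%N.
Proof.
apply/bigmax_leqP => k _; rewrite mxE unit_vecE.
have := rad_coord y x k; case: (k == i) => /=; lia.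
Qed.

Lemma rad_lower y (x : site d) i : (rad y x <= (rad y (x + unit_vec i)).+1)%N.
Proof.
apply/bigmax_leqP => k _.
have := rad_coord y (x + unit_vec i) k; rewrite mxE unit_vecE; case: (k == i) => /=; lia.
Qed.

Lemma big_bonds_in (S : {fset site d}) (h : bond d -> R) (P : pred (bond d)) :
  \sum_(e <- bonds_in S | P e) h e =
  \sum_(i < d) \sum_(x <- S | (x + unit_vec i \in S) && P (x, i)) h (x, i).
Proof.
transitivity (\sum_(e <- [seq (x, i) | i <- index_enum 'I_d, x <- (S : seq (site d))]
    | (upper e \in S) && P e) h e); last first.
  rewrite big_mkcond big_allpairs_dep /=; apply: eq_bigr => i _.
  by rewrite [RHS]big_mkcond.
rewrite -big_filter -[RHS]big_filter; apply: perm_big; apply: uniq_perm.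
- by rewrite filter_uniq// fset_uniq.
- rewrite filter_uniq//; apply: allpairs_uniq.
  + exact: index_enum_uniq.
  + exact: fset_uniq.
  + by move=> [i x] [j z] _ _ /= [-> ->].
move=> [x i]; rewrite !mem_filter in_bonds_in /lower /upper /=.
have -> : ((x, i) \in [seq (x0, i0) | i0 <- index_enum 'I_d, x0 <- (S : seq (site d))])
   = (x \in S).
  apply/allpairsP/idP => [[[j z]] /= [_ zS [-> _]] //|xS].
  by exists (i, x); rewrite /= mem_index_enum.
by case: (P _); case: (x \in S); case: (_ \in S).
Qed.

(** The coordinates on the box that identify it with a product of finite types. *)
Definition box_point y L (k : {ffun 'I_d -> 'I_(L.*2.+1)}) : site d :=
  y + \row_i ((k i : nat)%:Z - L%:Z).

Lemma box_pointE y L (k : {ffun 'I_d -> 'I_(L.*2.+1)}) i :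
  box_point y k 0 i = y 0 i + ((k i : nat)%:Z - L%:Z).
Proof. by rewrite !mxE. Qed.

Lemma box_point_inj y L : injective (@box_point y L).
Proof.
move=> k l /rowP E; apply/ffunP => i; apply/val_inj.
by move: (E i); rewrite !box_pointE => /addrI/addIr[].
Qed.

Lemma big_box y L (P : pred (site d)) f :
  \sum_(x <- box y L | P x) f x =
  \sum_(k : {ffun 'I_d -> 'I_(L.*2.+1)} | P (box_point y k)) f (box_point y k).
Proof.
rewrite big_mkcond [RHS]big_mkcond /box.
rewrite (@big_imfset _ _ _ _ _ _ (@box_point y L) _ (fun x => if P x then f x else 0))/=.
  by rewrite big_enum.
by move=> ? ? _ _; exact: box_point_inj.
Qed.

Lemma card_box y L : #|` box y L| = (L.*2.+1 ^ d)%N.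
Proof.
rewrite card_imfset /=; last exact: box_point_inj.
by rewrite -cardE card_ffun !card_ord.
Qed.

(** Outside the box the function vanishes, so it is the sum of its increments
    along the line in any direction [i]. *)
Lemma ler_line_sum y L f i (k : {ffun 'I_d -> 'I_(L.*2.+1)}) :
  (forall x, x \notin box y L -> f x = 0) ->
  `|f (box_point y k)| <= psum [set i] (fun l => `|nabla f (box_point y l, i)|) k.
Proof.
move=> f0.
pose G (s : nat) := box_point y k + (s%:Z - (k i : nat)%:Z) *: unit_vec i.
have GS s : G s.+1 = G s + unit_vec i.
  rewrite /G (_ : s.+1%:Z - (k i : nat)%:Z = s%:Z - (k i : nat)%:Z + 1); last by lia.
  by rewrite scalerDl scale1r addrA.
have -> : psum [set i] (fun l => `|nabla f (box_point y l, i)|) k =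
    \sum_(0 <= s < L.*2.+1) `|f (G s.+1) - f (G s)|.
  pose upd (s : 'I_(L.*2.+1)) := [ffun j => if j == i then s else k j].
  rewrite /psum (reindex upd) /=; last first.
    exists (fun l : {ffun 'I_d -> 'I_(L.*2.+1)} => l i) => [s _|l /agreeP lk].
      by rewrite ffunE eqxx.
    apply/ffunP => j; rewrite ffunE; case: eqP => [->//|/eqP ji].
    by rewrite lk// inE.
  rewrite big_mkord; apply: eq_big => [s|s _].
    by apply/agreeP => j; rewrite inE ffunE => /negbTE ->.
  rewrite /nabla /lower /upper /= GS; suff -> : box_point y (upd s) = G s by [].
  apply/rowP => j; rewrite box_pointE /G mxE box_pointE mxE unit_vecE ffunE.
  by case: eqP => [->|_]; lia.
have kL : (k i <= L.*2.+1)%N by exact/ltnW/ltn_ord.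
have -> : f (box_point y k) = - (f (G L.*2.+1) - f (G (k i))).
  rewrite [f (G L.*2.+1)]f0; first by rewrite sub0r opprK /G subrr scale0r addr0.
  rewrite in_box; apply/negP => /forallP/(_ i).
  by rewrite /G mxE box_pointE mxE unit_vecE eqxx; lia.
rewrite normrN -(telescope_sumr (f \o G) kL).
rewrite [X in _ <= X](big_cat_nat (n := k i))//=.
apply: le_trans (ler_norm_sum _ _ _) _; rewrite lerDr.
by apply: sumr_ge0.
Qed.

End Lattice.

(** * The Sobolev inequality on hyperplanes *)

Section Sobolev.
Variables (R : realType) (n : nat).
Hypothesis n0 : (0 < n)%N.
Local Notation d := n.+2.
Implicit Types (x y : site d) (f : site d -> R).

(** On the hyperplane the [n.+1] directions other than [j] are left, and in each
    of them [f] is at most the sum of its increments along a line. *)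
Lemma gagliardo_hyperplane y L f j sigma :
  (forall x, 0 <= f x) -> (forall x, x \notin box y L -> f x = 0) ->
  (forall x, x 0 j != sigma -> f x = 0) ->
  \sum_(x <- box y L) f x `^ (n.+1%:R / n%:R) <=
  (\sum_(i < d | i != j) \sum_(x <- box y L) `|nabla f (x, i)|)
    `^ (n.+1%:R / n%:R).
Proof.
move=> f0 fL fj.
have e0 : (n.+1%:R / n%:R : R) != 0 by rewrite mulf_neq0 ?invr_eq0 ?pnatr_eq0// -lt0n.
rewrite big_box.
have [/existsP[k fk]|] := boolP [exists k : {ffun 'I_d -> 'I_(L.*2.+1)}, f (box_point y k) != 0]; last first.
  rewrite negb_exists => /forallP fk0; rewrite big1 ?powR_ge0// => k _.
  by move: (fk0 k); rewrite negbK => /eqP ->; rewrite powR0.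
have kj : box_point y k 0 j = sigma by apply: contraNeq fk => /fj ->.
have cU : #|[set~ j]| = n.+1 by rewrite cardsC1 card_ord.
have := @gagliardo_nirenberg R _ _ [set~ j] n (fun i l => `|nabla f (box_point y l, i)|)
  (fun l => f (box_point y l)) k cU n0 (fun _ _ => normr_ge0 _) (fun _ => f0 _).
have fline i (l : {ffun 'I_d -> 'I_(L.*2.+1)}) : i \in [set~ j] ->
    f (box_point y l) <= psum [set i] (fun l => `|nabla f (box_point y l, i)|) l.
  by move=> _; rewrite -[X in X <= _]ger0_norm//; exact: ler_line_sum.
move=> /(_ fline) G; apply: le_trans (le_trans G _).
  rewrite /psum [X in _ <= X]big_mkcond; apply: ler_sum => l _.
  case: ifPn => // /agreeP kl; rewrite fj ?powR0//.
  apply/eqP => lj; apply: kl => i; rewrite !inE negbK => /eqP ->.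
  by apply/val_inj; move: lj; rewrite -kj !box_pointE => /addrI/addIr[].
apply: ler_powRl; first by rewrite divr_ge0.
  by apply: sumr_ge0 => i _; apply: psum_ge0.
rewrite (eq_bigl (fun i => i != j)); last by move=> i; rewrite !inE.
apply: ler_sum => i _; rewrite big_box /psum big_mkcond.
by apply: ler_sum => l _; case: ifP.
Qed.

(** The passage from exponent 1 to exponent [t]: the previous inequality is
    applied to [f ^ gamma], with [gamma] such that Hoelder's inequality
    reproduces the sum of [f ^ s] on the right-hand side. *)
Lemma sobolev_hyperplane y L' L f j sigma (s t : R) : (L' < L)%N ->
  1 < t -> 0 < s -> s^-1 = t^-1 - n.+1%:R^-1 ->
  (forall x, 0 <= f x) -> (forall x, x \notin box y L' -> f x = 0) ->
  (forall x, x 0 j != sigma -> f x = 0) ->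
  \sum_(x <- box y L) f x `^ s <=
  (2 * s * n%:R) `^ s *
  (\sum_(i < d | i != j) \sum_(x <- box y L) `|nabla f (x, i)| `^ t) `^ (s / t).
Proof.
move=> L'L t1 s0 st f0 fL' fj.
have n0R : (0 : R) < n%:R by rewrite ltr0n.
have n1R : (n.+1%:R : R) = n%:R + 1 by rewrite -natr1.
have fL x : x \notin box y L -> f x = 0.
  by move=> xL; apply: fL'; apply: contraNN xL; rewrite !mem_box => /leq_trans; apply; exact: ltnW.
(* the exponent gamma = s (D - 1) / D in dimension D = n + 1 *)
pose g := s * (n%:R / n.+1%:R).
have g0 : 0 < g by rewrite /g mulr_gt0 ?divr_gt0// ltr0n.
have sE : (n%:R + 1 - t) * s = t * (n%:R + 1).
  have : s * s^-1 = s * (t^-1 - n.+1%:R^-1) by rewrite st.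
  rewrite divff ?lt0r_neq0// n1R => e.
  have -> : t * (n%:R + 1) = t * (n%:R + 1) * (s * (t^-1 - (n%:R + 1)^-1)) by rewrite -e mulr1.
  by field; lra.
have gE : g = s * n%:R / (n%:R + 1) by rewrite /g n1R mulrA.
have gt : (g - 1) * (t / (t - 1)) = s.
  have h : (g - 1) * t = s * (t - 1).
    apply: (mulIf (lt0r_neq0 (_ : 0 < n%:R + 1 :> R))); first by lra.
    transitivity (s * n%:R * t - t * (n%:R + 1)); first by rewrite gE; field; lra.
    by rewrite -sE; ring.
  by rewrite mulrA h mulfK//; lra.
have g1 : 1 < g.
  have : 0 < (g - 1) * (t / (t - 1)) by rewrite gt.
  by rewrite pmulr_lgt0 ?divr_gt0 ?subr_gt0//; lra.
set A := \sum_(x <- box y L) f x `^ s.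
have A0 : 0 <= A by apply: sumr_ge0 => x _; exact: powR_ge0.
set Gt := \sum_(i < d | i != j) _.
have Gt0 : 0 <= Gt by apply: sumr_ge0 => i _; apply: sumr_ge0 => x _; exact: powR_ge0.
have AE : \sum_(x <- box y L) f x `^ s = A by [].
have GtE i : i != j -> \sum_(x <- box y L) `|nabla f (x, i)| `^ t <= Gt.
  move=> ij; rewrite /Gt (bigD1 i)//= lerDl; apply: sumr_ge0 => k _.
  by apply: sumr_ge0 => x _; exact: powR_ge0.
have gs : g * (n.+1%:R / n%:R) = s by rewrite /g n1R; field; lra.
clearbody A Gt g.
have [A_eq0|An0] := eqVneq A 0; first by rewrite A_eq0 mulr_ge0 ?powR_ge0.
have Ap : 0 < A by rewrite lt0r An0.
have tt : t^-1 + (t / (t - 1))^-1 = 1 by field; lra.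
have t0 : 0 < t by lra.
have t'0 : 0 < t / (t - 1) by rewrite divr_gt0// subr_gt0.
have dir i : i != j -> \sum_(x <- box y L) `|nabla (fun x => f x `^ g) (x, i)| <=
    2 * g * (Gt `^ t^-1 * A `^ (t / (t - 1))^-1).
  move=> ij.
  have hold (h : site d -> R) : (forall x, 0 <= h x) -> \sum_(x <- box y L) h x `^ s <= A ->
      \sum_(x <- box y L) `|nabla f (x, i)| * h x `^ (g - 1) <=
      Gt `^ t^-1 * A `^ (t / (t - 1))^-1.
    move=> h0 hA.
    have H := @holder_sum R _ (box y L : seq (site d)) xpredT
      (fun x => `|nabla f (x, i)|) (fun x => h x `^ (g - 1)) t (t / (t - 1))
      t0 t'0 tt (fun _ => normr_ge0 _) (fun _ => powR_ge0 _ _).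
    apply: (le_trans H).
    have t'V0 : 0 <= (t / (t - 1))^-1 by rewrite invr_ge0 (ltW t'0).
    apply: ler_pM (powR_ge0 _ _) (powR_ge0 _ _) _ _.
      apply: ler_powRl (GtE _ ij); first by rewrite invr_ge0 (ltW t0).
      by apply: sumr_ge0 => x _; exact: powR_ge0.
    apply: (ler_powRl t'V0); first by apply: sumr_ge0 => x _; exact: powR_ge0.
    by under eq_bigr do rewrite -powRrM gt.
  have /(hold f f0) H1 : \sum_(x <- box y L) f x `^ s <= A by rewrite AE.
  have H2 : \sum_(x <- box y L) `|nabla f (x, i)| * f (x + unit_vec i) `^ (g - 1) <=
      Gt `^ t^-1 * A `^ (t / (t - 1))^-1.
    apply: (hold (fun x => f (x + unit_vec i))) => [x|]; first exact: f0.
    rewrite -AE.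
    apply: (@ler_fsum_inj R _ _ _ _ xpredT xpredT (fun x => x + unit_vec i) (fun x => f x `^ s)).
    + exact: addIr.
    + by move=> x; exact: powR_ge0.
    + move=> x _ _; rewrite andbT; apply: contraNT => /fL ->.
      by rewrite powR0// lt0r_neq0.
  apply: (@le_trans _ _ (\sum_(x <- box y L)
     (g * (`|nabla f (x, i)| * f x `^ (g - 1)) +
      g * (`|nabla f (x, i)| * f (x + unit_vec i) `^ (g - 1))))).
    apply: ler_sum => x _; rewrite /nabla /upper /lower /=.
    by apply: (le_trans (powR_sub_le g1 (f0 _) (f0 _))); rewrite le_eqVlt; apply/orP; left; apply/eqP; ring.
  rewrite big_split /= -!mulr_sumr.
  have := ler_wpM2l (ltW g0) H1; have := ler_wpM2l (ltW g0) H2; lra.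
have := @gagliardo_hyperplane y L (fun x => f x `^ g) j sigma.
have -> : \sum_(x <- box y L) (f x `^ g) `^ (n.+1%:R / n%:R) = A.
  by rewrite -AE; apply: eq_bigr => x _; rewrite -powRrM gs.
move=> S1.
have {S1} : A <= (2 * s * n%:R * (Gt `^ t^-1 * A `^ (t / (t - 1))^-1)) `^ (n.+1%:R / n%:R).
  apply: le_trans (S1 _ _ _) _ => [x|x xL|x xj|].
  - exact: powR_ge0.
  - by rewrite fL// powR0// lt0r_neq0.
  - by rewrite fj// powR0// lt0r_neq0.
  apply: ler_powRl; first by rewrite divr_ge0.
    by apply: sumr_ge0 => i _; apply: sumr_ge0.
  apply: le_trans (ler_sum _ dir) _.
  rewrite sumr_const.
  have -> : #|fun i : 'I_d => i != j| = n.+1.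
    have jC := cardsC1 j; rewrite card_ord /= in jC; rewrite -[RHS]jC.
    by rewrite -cardsE; apply: eq_card => i; rewrite !inE.
  rewrite -[X in X <= _]mulr_natr gE n1R le_eqVlt; apply/orP; left; apply/eqP.
  by field; lra.
move=> S1.
have S2 : A `^ (n%:R / n.+1%:R) <= 2 * s * n%:R * (Gt `^ t^-1 * A `^ (t / (t - 1))^-1).
  rewrite -[n%:R / n.+1%:R]invrK invf_div.
  apply: le_trans (ler_powRl _ A0 S1) _; first by rewrite invr_ge0 divr_ge0.
  rewrite powRK//; first by rewrite !mulr_ge0 ?powR_ge0// ltW.
  by rewrite mulf_neq0 ?invr_eq0 ?pnatr_eq0// -lt0n.
have S3 : A `^ s^-1 <= 2 * s * n%:R * Gt `^ t^-1.
  have -> : s^-1 = n%:R / n.+1%:R - (t / (t - 1))^-1.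
    by rewrite st n1R; field; lra.
  rewrite powRB; last by rewrite An0 implybT.
  by rewrite ler_pdivrMr ?powR_gt0// -[X in _ <= X]mulrA.
have -> : (2 * s * n%:R) `^ s * Gt `^ (s / t) = (2 * s * n%:R * Gt `^ t^-1) `^ s.
  rewrite [RHS]powRM ?powR_ge0 ?mulr_ge0 ?ltW// -powRrM; congr (_ * _ `^ _).
  by rewrite mulrC.
by rewrite -[X in X <= _](powRVK A0 (lt0r_neq0 s0)); apply: ler_powRl; rewrite ?powR_ge0// ltW.
Qed.

End Sobolev.

(** * The bonds between two consecutive radii *)

Section Layers.
Variable R : realType.

Definition layer d (y : site d) (i : 'I_d) r (x : site d) :=
  (absz (x 0 i - y 0 i)%R == r) || (absz (x 0 i - y 0 i)%R == r.+1).

Definition cross d (y : site d) r (e : bond d) :=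
  (minn (rad y (lower e)) (rad y (upper e)) == r) &&
  (maxn (rad y (lower e)) (rad y (upper e)) == r.+1).

Lemma layer_cases (a b : int) r :
  (absz (a - b)%R == r) || (absz (a - b)%R == r.+1) ->
  [|| a == b + r%:Z, a == b - r%:Z, a == b + r.+1%:Z | a == b - r.+1%:Z].
Proof. by lia. Qed.

(** The norm changes along a bond of direction [i] only if the [i]-th coordinate
    attains it, so both end-points lie on hyperplanes orthogonal to [i]. *)
Lemma cross_layer d (y : site d) r e : cross y r e ->
  layer y e.2 r (lower e) && layer y e.2 r (upper e).
Proof.
case: e => x i; rewrite /cross /lower /upper /= => /andP[/eqP mn /eqP mx].
have d0 : (0 < #|'I_d|)%N by rewrite card_ord; exact: leq_ltn_trans (ltn_ord i).
have [k kP] := bigop.eq_bigmax (fun k => absz (x 0 k - y 0 k)%R) d0.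
have [l lP] := bigop.eq_bigmax (fun k => absz ((x + unit_vec i) 0 k - y 0 k)%R) d0.
rewrite -/(rad y x) in kP; rewrite -/(rad y (x + unit_vec i)) in lP.
have xi := rad_coord y x i; have xl := rad_coord y x l.
have ui := rad_coord y (x + unit_vec i) i; have uk := rad_coord y (x + unit_vec i) k.
rewrite mxE unit_vecE ?eqxx in ui; rewrite mxE unit_vecE in uk; rewrite mxE unit_vecE in lP.
rewrite /layer mxE unit_vecE eqxx mulr1n in ui *.
move: mn mx kP xi xl uk lP ui.
move: (rad y x) (rad y (x + unit_vec i)) => a b.
have [->|ki] := eqVneq k i; have [->|li] := eqVneq l i; rewrite ?mulr1n ?mulr0n ?addr0;
  rewrite ?[_ + 1 - _]addrAC; move: (x 0 i - y 0 i) => xi.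
- lia.
- move: (x 0 l - y 0 l) => xl; lia.
- move: (x 0 k - y 0 k) => xk; lia.
- move: (x 0 k - y 0 k) (x 0 l - y 0 l) => xk xl; lia.
Qed.

Lemma mulr_powR_le (a b r : R) : 0 <= a -> 0 <= b -> 0 <= r ->
  (a * b) `^ r <= a `^ (2 * r) + b `^ (2 * r).
Proof.
move=> a0 b0 r0; rewrite powRM//.
have sq (c : R) : c `^ (2 * r) = c `^ r * c `^ r.
  by rewrite mulrC powRrM powR_mulrn ?powR_ge0// expr2.
rewrite !sq; have := sqr_ge0 (a `^ r - b `^ r).
have := powR_ge0 a r; have := powR_ge0 b r; nra.
Qed.

Lemma cross_sum_le d (y : site d) L r (W : site d -> R) : (forall x, 0 <= W x) ->
  \sum_(e <- bonds_in (box y L) | cross y r e) (W (lower e) + W (upper e)) <=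
  2 * \sum_(i < d) \sum_(x <- box y L | layer y i r x) W x.
Proof.
move=> W0; rewrite big_split /= mulr2n mulrDl mul1r; apply: lerD.
  rewrite (@big_bonds_in _ _ _ (fun e => W (lower e))); apply: ler_sum => i _.
  apply: (ler_fsum W0) => x xS /andP[_ /cross_layer/andP[+ _]] _.
  by rewrite xS.
rewrite (@big_bonds_in _ _ _ (fun e => W (upper e))); apply: ler_sum => i _.
apply: (@ler_fsum_inj R _ _ _ _ _ _ (fun x => x + unit_vec i) W) => //.
  exact: addIr.
by move=> x _ /andP[xS /cross_layer/andP[_]] + _; rewrite xS.
Qed.

(** The contribution of one radius to the energy, with [v] the excess over the new
    level and [w] the one over the old level. *)
Lemma cross_energy d (y : site d) L r (p p' s H : R)
    (omega : bond d -> R) (v w : site d -> R) :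
  0 < p -> 0 < p' -> p^-1 + p'^-1 = 1 -> 0 <= H ->
  (forall e, 0 <= omega e) -> (forall x, 0 <= v x) ->
  (forall x, (rad y x <= r.+1)%N -> v x `^ (2 * p') <= H * w x `^ s) ->
  \sum_(e <- bonds_in (box y L) | cross y r e) omega e * (v (lower e) * v (upper e)) <=
  (\sum_(e <- bonds_in (box y L) | cross y r e) omega e `^ p) `^ p^-1 *
  (2 * H * \sum_(i < d) \sum_(x <- box y L | layer y i r x) w x `^ s) `^ p'^-1.
Proof.
move=> p0 p'0 pp' H0 om0 v0 vw.
have := @holder_sum R _ (bonds_in (box y L) : seq (bond d)) (cross y r) omega
  (fun e => v (lower e) * v (upper e)) p p' p0 p'0 pp' om0
  (fun e => mulr_ge0 (v0 _) (v0 _)).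
move=> /le_trans; apply; apply: ler_wpM2l; first exact: powR_ge0.
apply: ler_powRl; first by rewrite invr_ge0 ltW.
  by apply: sumr_ge0 => e _; exact: powR_ge0.
have := @cross_sum_le d y L r (fun x => w x `^ s) (fun x => powR_ge0 _ _).
move=> /(ler_wpM2l H0) h; rewrite -[2 * H]mulrC -mulrA; apply: le_trans h.
rewrite mulr_sumr; apply: ler_sum => e /andP[_ /eqP mx].
apply: (le_trans (mulr_powR_le (v0 _) (v0 _) (ltW p'0))); rewrite mulrDr.
by apply: lerD; apply: vw; rewrite -mx leq_max leqnn ?orbT.
Qed.

Section LayerSobolev.
Variables (n : nat) (y : site n.+2) (L' L : nat) (s t : R) (w : site n.+2 -> R).
Hypotheses (n0 : (0 < n)%N) (L'L : (L' < L)%N) (t1 : 1 < t) (s0 : 0 < s)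
  (st : s^-1 = t^-1 - n.+1%:R^-1)
  (w0 : forall x, 0 <= w x) (wL' : forall x, x \notin box y L' -> w x = 0).
Let grad x := \sum_i `|nabla w (x, i)| `^ t.

Lemma sobolev_slice j sigma :
  \sum_(x <- box y L | x 0 j == sigma) w x `^ s <=
  (2 * s * n%:R) `^ s * (\sum_(x <- box y L | x 0 j == sigma) grad x) `^ (s / t).
Proof.
pose f (x : site n.+2) := if x 0 j == sigma then w x else 0.
have f0 x : 0 <= f x by rewrite /f; case: ifP.
have fL' x : x \notin box y L' -> f x = 0 by move=> /wL' wx; rewrite /f wx if_same.
have fj (x : site n.+2) : x 0 j != sigma -> f x = 0 by rewrite /f => /negbTE ->.
have := sobolev_hyperplane n0 L'L t1 s0 st f0 fL' fj.
set c := _ `^ s; have c0 : 0 <= c by exact: powR_ge0.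
have -> : \sum_(x <- box y L | x 0 j == sigma) w x `^ s = \sum_(x <- box y L) f x `^ s.
  rewrite big_mkcond; apply: eq_bigr => x _; rewrite /f.
  by case: ifP => // _; rewrite powR0// lt0r_neq0.
move=> /le_trans; apply; apply: (ler_wpM2l c0); apply: ler_powRl.
- by rewrite divr_ge0// ltW// (lt_trans _ t1).
- by apply: sumr_ge0 => i _; apply: sumr_ge0 => x _; exact: powR_ge0.
rewrite exchange_big big_mkcond [X in _ <= X]big_mkcond /=; apply: ler_sum => x _.
have E i : i != j -> `|nabla f (x, i)| `^ t =
    if x 0 j == sigma then `|nabla w (x, i)| `^ t else 0.
  move=> ij; rewrite /nabla /f /upper /lower /= mxE unit_vecE [j == i]eq_sym (negbTE ij) addr0.
  by case: ifP => // _; rewrite subrr normr0 powR0// lt0r_neq0// (lt_trans _ t1).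
rewrite (eq_bigr _ E); case: ifP => _; last by rewrite big1.
rewrite /grad [X in _ <= X](bigID (fun i => i != j)) /= lerDl.
by apply: sumr_ge0 => i _; exact: powR_ge0.
Qed.

(** A layer of direction [i] consists of at most four hyperplanes. *)
Lemma layer_sobolev r :
  \sum_i \sum_(x <- box y L | layer y i r x) w x `^ s <=
  n.+2%:R * (4 * (2 * s * n%:R) `^ s) *
  (\sum_i \sum_(x <- box y L | layer y i r x) grad x) `^ (s / t).
Proof.
have st0 : 0 <= s / t by rewrite divr_ge0// ltW// (lt_trans _ t1).
have g0 x : 0 <= grad x by apply: sumr_ge0 => i _; exact: powR_ge0.
set c := _ `^ s; have c0 : 0 <= c by exact: powR_ge0.
set B := (X in _ * X `^ _).
have BE i : \sum_(x <- box y L | layer y i r x) grad x <= B.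
  rewrite /B (bigD1 i)//= lerDl.
  by apply: sumr_ge0 => k _; apply: sumr_ge0.
clearbody B; set E := B `^ _.
have E0 : 0 <= E by exact: powR_ge0.
suff H i : \sum_(x <- box y L | layer y i r x) w x `^ s <= 4 * c * E.
  apply: le_trans (ler_sum _ (fun i _ => H i)) _.
  by rewrite sumr_const card_ord -[_ *+ n.+2]mulr_natl -[X in _ <= X]mulrA.
have HS (a : int) : absz a = r \/ absz a = r.+1 ->
    \sum_(x <- box y L | x 0 i == y 0 i + a) w x `^ s <= c * E.
  move=> hs; apply: (le_trans (sobolev_slice i (y 0 i + a))).
  apply: (ler_wpM2l c0); apply: (ler_powRl st0); first exact: sumr_ge0.
  apply: le_trans (BE i); apply: (ler_fsum g0) => x xS /eqP xi _; rewrite xS /layer xi addrAC subrr add0r.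
  by case: hs => ->; rewrite eqxx ?orbT.
have h1 := HS r%:Z (or_introl erefl); have h2 := HS (- r%:Z) (or_introl (abszN _)).
have h3 := HS r.+1%:Z (or_intror erefl); have h4 := HS (- r.+1%:Z) (or_intror (abszN _)).
apply: (@le_trans _ _ (\sum_(x <- box y L)
   ((if x 0 i == y 0 i + r%:Z then w x `^ s else 0) +
   (if x 0 i == y 0 i - r%:Z then w x `^ s else 0) +
   ((if x 0 i == y 0 i + r.+1%:Z then w x `^ s else 0) +
   (if x 0 i == y 0 i - r.+1%:Z then w x `^ s else 0))))); last first.
  by rewrite !big_split /= -!big_mkcond /=; lra.
rewrite big_mkcond; apply: ler_sum => x _.
have W := powR_ge0 (w x) s.
have Z (b : bool) : 0 <= (if b then w x `^ s else 0) by case: b.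
rewrite /layer.
have Z1 := Z (x 0 i == y 0 i + r%:Z); have Z2 := Z (x 0 i == y 0 i - r%:Z).
have Z3 := Z (x 0 i == y 0 i + r.+1%:Z); have Z4 := Z (x 0 i == y 0 i - r.+1%:Z).
case: ifP => [|_]; last by rewrite !addr_ge0.
move=> /layer_cases /or4P[] /eqP E1; rewrite E1 eqxx in Z1 Z2 Z3 Z4 *; lra.
Qed.

End LayerSobolev.
End Layers.

(** * The energy estimate with a radial cutoff *)

Section Energy.
Variable R : realType.

Lemma outer_bond d (y : site d) L' L (x : site d) i : (L' < L)%N ->
  x + unit_vec i \notin box y L -> x \notin box y L'.
Proof. by rewrite !mem_box => L'L; have := rad_upper y x i; lia. Qed.

Lemma sum_by_parts d (y : site d) L' L (F : bond d -> R) (phi : site d -> R) :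
  (L' < L)%N -> (forall x, x \notin box y L' -> phi x = 0) ->
  (forall x, nabla_star F x = 0) ->
  \sum_(e <- bonds_in (box y L)) F e * nabla phi e = 0.
Proof.
move=> L'L phiL F0.
have phi0 x : x \notin box y L -> phi x = 0.
  by move=> xL; apply: phiL; apply: contraNN xL; rewrite !mem_box => /leq_trans; apply; exact: ltnW.
have : \sum_(x <- box y L) phi x * nabla_star F x = 0.
  by rewrite big1// => x _; rewrite F0 mulr0.
under eq_bigr do rewrite /nabla_star mulr_sumr.
rewrite exchange_big /= big_bonds_in => E; rewrite -[RHS]E.
apply: eq_bigr => i _.
have -> : \sum_(x <- box y L) phi x * (F (x - unit_vec i, i) - F (x, i)) =
    \sum_(x <- box y L) F (x, i) * (phi (x + unit_vec i) - phi x).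
  under eq_bigr do rewrite mulrBr.
  under [RHS]eq_bigr do rewrite mulrBr.
  rewrite !sumrB; congr (_ - _); last by apply: eq_bigr => x _; rewrite mulrC.
  pose h (x : site d) := phi x * F (x - unit_vec i, i).
  have -> : \sum_(x <- box y L) F (x, i) * phi (x + unit_vec i) =
      \sum_(x <- [fset (x + unit_vec i)%R | x in box y L]%fset) h x.
    rewrite [RHS]big_imfset/=; last by move=> ? ? _ _; exact: addIr.
    by apply: eq_bigr => x _; rewrite /h addrK mulrC.
  apply: eq_fsum => x; rewrite /h mulf_eq0 negb_or => /andP[phix _].
  have xL' : x \in box y L' by apply: contraNT phix => /phiL ->.
  have -> : x \in box y L by apply: contraNT phix => /phi0 ->.
  apply/esym/imfsetP; exists (x - unit_vec i); last by rewrite subrK.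
  have := rad_lower y (x - unit_vec i) i; rewrite subrK /= mem_box.
  by move: xL'; rewrite mem_box; lia.
rewrite [LHS]big_mkcond; apply: eq_big_seq => x xS.
rewrite andbT; case: ifPn => // xe.
by rewrite (phi0 _ xe) (phiL _ (outer_bond L'L xe)) subrr mulr0.
Qed.

(** Testing the equation against [eta ^ 2 * v], with [v] the part of [u] above
    the level [k].  On each bond
    [(a - b) (A ^ 2 a - B ^ 2 b) = (A a - B b) ^ 2 - a b (A - B) ^ 2],
    so the energy of [eta * v] is controlled by the bonds where [eta] varies. *)
Lemma caccioppoli d (y : site d) L' L (omega : bond d -> R) (u eta : site d -> R) k :
  let v x := Num.max 0 (u x - k) in
  (L' < L)%N -> (forall e, 0 < omega e) ->
  (forall x, x \notin box y L' -> eta x = 0) ->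
  (forall x, nabla_star (fun e => omega e * nabla u e) x = 0) ->
  \sum_(e <- bonds_in (box y L)) omega e * nabla (fun x => eta x * v x) e ^+ 2 <=
  \sum_(e <- bonds_in (box y L))
    omega e * (v (lower e) * v (upper e)) * nabla eta e ^+ 2.
Proof.
move=> v L'L om0 etaL hu.
have := @sum_by_parts d y L' L _ (fun x => eta x ^+ 2 * v x) L'L _ hu.
have vL x : x \notin box y L' -> eta x ^+ 2 * v x = 0.
  by move=> /etaL ->; rewrite expr0n mul0r.
move=> /(_ vL) E0; rewrite -[X in _ <= X]addr0 -[X in _ + X]E0 -big_split /=.
apply: ler_sum => e _; rewrite -!mulrA -mulrDr; apply: ler_wpM2l; first exact: ltW.
rewrite /nabla /v.
move: (u (lower e)) (u (upper e)) (eta (lower e)) (eta (upper e)) => a b A B.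
have A2 := sqr_ge0 A; have B2 := sqr_ge0 B.
case: (ltP 0 (a - k)) => ak; case: (ltP 0 (b - k)) => bk; rewrite ?mulr0 ?subr0 ?sub0r ?mul0r ?add0r.
- by nra.
- have kb : 0 <= k - b by lra.
  by have := mulr_ge0 (mulr_ge0 A2 (ltW ak)) kb; nra.
- have ka : 0 <= k - a by lra.
  by have := mulr_ge0 (mulr_ge0 B2 (ltW bk)) ka; nra.
- by rewrite expr0n mulr0.
Qed.

(** The radial profile that decreases from 1 to 0 in equal steps on the radii of
    [G]. *)
Definition cutoff (G : seq nat) (r : nat) : R := (count (leq r) G)%:R / (size G)%:R.

Lemma cutoff_ge0 G r : 0 <= cutoff G r.
Proof. by rewrite divr_ge0. Qed.

Lemma cutoff1 G r : (0 < size G)%N -> all (leq r) G -> cutoff G r = 1.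
Proof.
by rewrite all_count /cutoff => G0 /eqP ->; rewrite divff// pnatr_eq0 -lt0n.
Qed.

Lemma cutoff0 G r : all (fun g => g < r)%N G -> cutoff G r = 0.
Proof.
move=> /allP Gr; rewrite /cutoff (_ : count _ _ = 0%N) ?mul0r//.
apply/eqP; rewrite -leqn0 leqNgt -has_count; apply/hasPn => g /Gr.
by rewrite -ltnNge.
Qed.

Lemma cutoffS G r : cutoff G r - cutoff G r.+1 = (count_mem r G)%:R / (size G)%:R.
Proof.
rewrite /cutoff -mulrBl; congr (_ / _).
suff -> : count (leq r) G = (count_mem r G + count (leq r.+1) G)%N by rewrite natrD addrK.
by elim: G => //= g G ->; case: (ltngtP r g) => //=; lia.
Qed.

Lemma cutoff_gradient d (y : site d) (G : seq nat) (e : bond d) : uniq G ->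
  nabla (fun x => cutoff G (rad y x)) e ^+ 2 =
  \sum_(r <- G | cross y r e) ((size G)%:R^-1) ^+ 2.
Proof.
move=> Gu; rewrite /nabla.
have [/eqP rr|rr] := boolP (rad y (lower e) == rad y (upper e)).
  by rewrite rr subrr expr0n big_pred0// => r; rewrite /cross rr minnn maxnn; lia.
have [r [rP cr]] : exists r, (cutoff G (rad y (upper e)) - cutoff G (rad y (lower e))) ^+ 2 =
    (cutoff G r - cutoff G r.+1) ^+ 2 /\ (forall r', cross y r' e = (r' == r)).
  have := rad_upper y (lower e) e.2; have := rad_lower y (lower e) e.2.
  rewrite -[lower e + unit_vec e.2]/(upper e) => h1 h2; rewrite /cross.
  case: (ltngtP (rad y (lower e)) (rad y (upper e))) rr => // rr _.
    exists (rad y (lower e)); have -> : rad y (upper e) = (rad y (lower e)).+1 by lia.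
    by split; [rewrite -sqrrN opprB | move=> r'; lia].
  exists (rad y (upper e)); have -> : rad y (lower e) = (rad y (upper e)).+1 by lia.
  by split => // r'; lia.
rewrite rP cutoffS (eq_bigl _ _ cr) count_uniq_mem// big_const_seq count_uniq_mem//.
by case: (r \in G); rewrite /= ?addr0 ?mul1r// mul0r expr0n.
Qed.

(** Since a radial cutoff only varies on the bonds that cross the radii of [G],
    the energy is an average over [G] of the contributions of single radii. *)
Lemma cutoff_caccioppoli d (y : site d) (G : seq nat) N L
    (omega : bond d -> R) (u : site d -> R) k :
  let v x := Num.max 0 (u x - k) in
  uniq G -> (forall r, r \in G -> (r < N)%N) -> (0 < size G)%N -> (N <= L)%N ->
  (forall e, 0 < omega e) ->
  (forall x, nabla_star (fun e => omega e * nabla u e) x = 0) ->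
  \sum_(e <- bonds_in (box y L)) omega e *
    nabla (fun x => cutoff G (rad y x) * v x) e ^+ 2 <=
  (size G)%:R^-1 ^+ 2 * \sum_(r <- G) \sum_(e <- bonds_in (box y L) | cross y r e)
    omega e * (v (lower e) * v (upper e)).
Proof.
move=> v Gu GN G0 NL om0 hu.
have [N' NE] : exists N', N = N'.+1.
  case: G {Gu} GN G0 => // g G /(_ g (mem_head _ _)).
  by case: N {NL} => // N _ _; exists N.
have N'L : (N' < L)%N by rewrite -NE.
have etaL x : x \notin box y N' -> cutoff G (rad y x) = 0.
  rewrite mem_box -ltnNge => xN; apply: cutoff0; apply/allP => g /GN.
  by rewrite NE; lia.
apply: (le_trans (@caccioppoli d y N' L omega u _ k N'L om0 etaL hu)).
under eq_bigr do rewrite cutoff_gradient// mulr_sumr big_mkcond.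
rewrite exchange_big mulr_sumr /=; apply: ler_sum => r _.
by rewrite -big_mkcond -mulr_suml mulrC.
Qed.

End Energy.

(** * One step of the iteration *)

Section GoodRadii.
Variable R : realType.

Lemma markov_count (T : eqType) (l : seq T) (a : T -> R) A c :
  (forall r, 0 <= a r) -> 0 <= c -> \sum_(r <- l) a r <= A ->
  (count (fun r => c * A < a r) l)%:R * (c * A) <= A.
Proof.
move=> a0 c0 aA; apply: le_trans aA.
rewrite -sum1_count natr_sum mulr_suml.
rewrite [X in _ <= X](bigID (fun r => c * A < a r)) /= -[X in X <= _]addr0.
apply: lerD; last exact: sumr_ge0.
by apply: ler_sum => r /ltW; rewrite mul1r.
Qed.

Lemma markov_count_le (T : eqType) (l : seq T) (a : T -> R) A c :
  (forall r, 0 <= a r) -> 0 < c -> \sum_(r <- l) a r <= A ->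
  (count (fun r => c * A < a r) l)%:R <= c^-1.
Proof.
move=> a0 c0 aA.
have A0 : 0 <= A by apply: le_trans aA; exact: sumr_ge0.
have [A_eq0|An0] := eqVneq A 0; last first.
  have Ap : 0 < A by rewrite lt0r An0.
  rewrite -[X in _ <= X]mul1r ler_pdivlMr// -(ler_pM2r Ap) mul1r -mulrA.
  exact: markov_count a0 (ltW c0) aA.
suff -> : count (fun r => c * A < a r) l = 0%N by rewrite invr_ge0 ltW.
apply/eqP; rewrite -leqn0 leqNgt -has_count; apply/hasPn => r rl.
rewrite -leNgt A_eq0 mulr0 -A_eq0; apply: le_trans aA.
by rewrite (big_rem r)//= lerDl; exact: sumr_ge0.
Qed.

(** By Markov's inequality at most a third of the radii is bad for [a], and at
    most a third is bad for [b]. *)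
Lemma good_radii N (a b : nat -> R) A B : (0 < N)%N ->
  (forall r, 0 <= a r) -> (forall r, 0 <= b r) ->
  \sum_(N <= r < N + N) a r <= A -> \sum_(N <= r < N + N) b r <= B ->
  exists G : seq nat, [/\ uniq G, forall r, r \in G -> (N <= r < N + N)%N,
    N%:R <= 3 * (size G)%:R :> R &
    forall r, r \in G -> a r <= 3 / N%:R * A /\ b r <= 3 / N%:R * B].
Proof.
move=> N0 a0 b0; rewrite /index_iota addnK => aA bB.
pose good r := (a r <= 3 / N%:R * A) && (b r <= 3 / N%:R * B).
have NR : 0 < N%:R :> R by rewrite ltr0n.
have c0 : 0 < 3 / N%:R :> R by rewrite divr_gt0.
exists [seq r <- iota N N | good r]; split.
- by rewrite filter_uniq// iota_uniq.
- by move=> r; rewrite mem_filter mem_iota => /andP[].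
- have := markov_count_le a0 c0 aA; have := markov_count_le b0 c0 bB.
  set ca := count _ _; set cb := count _ _; rewrite invf_div size_filter.
  have : (N <= cb + ca + count good (iota N N))%N.
    rewrite -[X in (X <= _)%N](size_iota N N) -(count_predC good) addnC leq_add2r.
    rewrite /ca /cb -count_predUI; apply: leq_trans (leq_addr _ _).
    apply: sub_count => r /=; rewrite /good negb_and -!ltNge.
    by case/orP => ->; rewrite ?orbT.
  rewrite -(ler_nat R) !natrD => h1 h2 h3; lra.
- by move=> r; rewrite mem_filter => /andP[/andP[]].
Qed.

End GoodRadii.

Section Step.
Variable R : realType.

Lemma sum_count_le (T I : Type) (l : seq I) (S : seq T) (P : I -> T -> bool)
    (f : T -> R) m :
  (forall e, 0 <= f e) -> (forall e, (count (fun r => P r e) l <= m)%N) ->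
  \sum_(r <- l) \sum_(e <- S | P r e) f e <= m%:R * \sum_(e <- S) f e.
Proof.
move=> f0 cm; under eq_bigr do rewrite big_mkcond.
rewrite exchange_big mulr_sumr /=; apply: ler_sum => e _.
rewrite -big_mkcond /= (eq_bigr (fun _ => 1%:R * f e)); last by move=> r _; rewrite mul1r.
by rewrite -mulr_suml -natr_sum sum1_count; apply: ler_wpM2r => //; rewrite ler_nat.
Qed.

Lemma count_cross d (y : site d) l e : uniq l -> (count (fun r => cross y r e) l <= 1)%N.
Proof.
move=> lu; apply: (@leq_trans (count_mem (minn (rad y (lower e)) (rad y (upper e))) l)).
  by apply: sub_count => r /andP[/eqP <- _] /=.
by rewrite count_uniq_mem// leq_b1.
Qed.

Lemma count_layer d (y : site d) i l (x : site d) : uniq l ->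
  (count (fun r => layer y i r x) l <= 2)%N.
Proof.
move=> lu; set a := absz (x 0 i - y 0 i)%R.
apply: (@leq_trans (count_mem a l + count_mem a.-1 l)).
  rewrite -count_predUI; apply: leq_trans (leq_addr _ _).
  by apply: sub_count => r /=; rewrite /layer -/a; lia.
by rewrite !count_uniq_mem//; case: (a \in l); case: (_ \in l).
Qed.

Lemma grad_bonds d (y : site d) L' L (w : site d -> R) t : (L' < L)%N -> 0 < t ->
  (forall x, x \notin box y L' -> w x = 0) ->
  \sum_(x <- box y L) \sum_i `|nabla w (x, i)| `^ t =
  \sum_(e <- bonds_in (box y L)) `|nabla w e| `^ t.
Proof.
move=> L'L t0 wL'; rewrite exchange_big /= big_bonds_in; apply: eq_bigr => i _.
rewrite [RHS]big_mkcond; apply: eq_bigr => x _; rewrite andbT.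
case: ifPn => // xe; have xL' := outer_bond L'L xe.
have xeL' : x + unit_vec i \notin box y L'.
  by apply: contraNN xe; rewrite !mem_box => /leq_trans; apply; exact: ltnW.
by rewrite /nabla /upper /lower /= !wL'// subrr normr0 powR0// lt0r_neq0.
Qed.

(** The factors 3 come from [good_radii], the factor [2 * n.+2] in the last one
    from the number of layers that contain a site, and the remaining ones from
    [cross_energy] and [layer_sobolev]. *)
Definition step_const n (p p' s t : R) : R :=
  3 * 3 `^ p^-1 * (2 * (n.+2%:R * (4 * (2 * s * n%:R) `^ s))) `^ p'^-1 *
  (3 * (2 * n.+2%:R)) `^ (s / t / p').

(** On good radii both the conductances and the gradient of [w] have at most three
    times their average size, and on the hyperplanes that carry a radius the
    Sobolev inequality in dimension [n.+1] bounds [w]. *)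
Lemma energy_step n (y : site n.+2) N L' L (p p' s t H k : R)
    (omega : bond n.+2 -> R) (u w : site n.+2 -> R) :
  let v x := Num.max 0 (u x - k) in
  (0 < n)%N -> (0 < N)%N -> (N + N <= L)%N -> (L' < L)%N ->
  0 < p -> 0 < p' -> p^-1 + p'^-1 = 1 ->
  1 < t -> 0 < s -> s^-1 = t^-1 - n.+1%:R^-1 -> 0 <= H ->
  (forall e, 0 < omega e) ->
  (forall x, nabla_star (fun e => omega e * nabla u e) x = 0) ->
  (forall x, 0 <= w x) -> (forall x, x \notin box y L' -> w x = 0) ->
  (forall x, (rad y x <= N + N)%N -> v x `^ (2 * p') <= H * w x `^ s) ->
  exists G : seq nat, [/\ (0 < size G)%N, forall r, r \in G -> (N <= r < N + N)%N &
    \sum_(e <- bonds_in (box y L)) omega e *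
      nabla (fun x => cutoff R G (rad y x) * v x) e ^+ 2 <=
    step_const n p p' s t * N%:R `^ (- (1 + p^-1 + s / t / p')) *
    (\sum_(e <- bonds_in (box y L)) omega e `^ p) `^ p^-1 * H `^ p'^-1 *
    (\sum_(e <- bonds_in (box y L)) `|nabla w e| `^ t) `^ (s / t / p')].
Proof.
move=> v n0 N0 NL L'L p0 p'0 pp' t1 s0 st H0 om0 hu w0 wL' vw.
have t0 : 0 < t by exact: lt_trans t1.
set Ap := \sum_(e <- bonds_in (box y L)) omega e `^ p.
rewrite -(grad_bonds L'L t0 wL').
set X := \sum_(x <- box y L) _.
have Ap0 : 0 <= Ap by apply: sumr_ge0 => e _; exact: powR_ge0.
have g0 x : 0 <= \sum_i `|nabla w (x, i)| `^ t by apply: sumr_ge0 => i _; exact: powR_ge0.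
have X0 : 0 <= X by exact: sumr_ge0.
pose a r := \sum_(e <- bonds_in (box y L) | cross y r e) omega e `^ p.
pose b r := \sum_i \sum_(x <- box y L | layer y i r x) \sum_i `|nabla w (x, i)| `^ t.
have a0 r : 0 <= a r by apply: sumr_ge0 => e _; exact: powR_ge0.
have b0 r : 0 <= b r by apply: sumr_ge0 => i _; exact: sumr_ge0.
have aA : \sum_(N <= r < N + N) a r <= Ap.
  have := @sum_count_le _ _ (index_iota N (N + N)) (bonds_in (box y L) : seq (bond n.+2))
    (cross y) (fun e => omega e `^ p) 1 (fun e => powR_ge0 _ _)
    (fun e => count_cross y e (iota_uniq _ _)).
  by rewrite mul1r.
have bB : \sum_(N <= r < N + N) b r <= 2 * n.+2%:R * X.
  rewrite exchange_big /=.
  apply: (@le_trans _ _ (\sum_(i < n.+2) 2 * X)); last first.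
    by rewrite sumr_const card_ord -[_ *+ n.+2]mulr_natl mulrA [_ * 2]mulrC.
  apply: ler_sum => i _; exact: (@sum_count_le _ _ (index_iota N (N + N)) (box y L : seq (site n.+2))
    (layer y i) _ 2 g0 (fun x => count_layer y i x (iota_uniq _ _))).
have [G [Gu GN GS Gab]] := good_radii N0 a0 b0 aA bB.
have NR : 0 < N%:R :> R by rewrite ltr0n.
have G0 : (0 < size G)%N.
  by rewrite -(ltr_nat R); lra.
exists G; split => //.
pose C1 : R := n.+2%:R * (4 * (2 * s * n%:R) `^ s).
have C10 : 0 <= C1 by rewrite /C1 !mulr_ge0 ?powR_ge0.
have iN : 0 <= 3 / N%:R :> R by rewrite divr_ge0.
have st0 : 0 <= s / t by rewrite divr_ge0 ?ltW.
have ip : 0 <= p^-1 by rewrite invr_ge0 ltW.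
have ip' : 0 <= p'^-1 by rewrite invr_ge0 ltW.
pose M := (3 / N%:R * Ap) `^ p^-1 *
  (2 * H * (C1 * (3 / N%:R * (2 * n.+2%:R * X)) `^ (s / t))) `^ p'^-1.
have M0 : 0 <= M by rewrite mulr_ge0 ?powR_ge0.
have GM r : r \in G -> \sum_(e <- bonds_in (box y L) | cross y r e)
     omega e * (v (lower e) * v (upper e)) <= M.
  move=> rG; have [ar br] := Gab r rG.
  have v0 x : 0 <= v x by rewrite /v le_max lexx.
  have vwr x : (rad y x <= r.+1)%N -> v x `^ (2 * p') <= H * w x `^ s.
    by move=> xr; apply: vw; apply: leq_trans xr _; have /andP[] := GN r rG.
  apply: (le_trans (cross_energy L p0 p'0 pp' H0 (fun e => ltW (om0 e)) v0 vwr)).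
  apply: ler_pM (powR_ge0 _ _) (powR_ge0 _ _) (ler_powRl ip (a0 r) ar) _.
  apply: (ler_powRl ip').
    rewrite !mulr_ge0//; apply: sumr_ge0 => i _; apply: sumr_ge0 => x _; exact: powR_ge0.
  apply: ler_wpM2l; first by rewrite mulr_ge0.
  apply: (le_trans (layer_sobolev n0 L'L t1 s0 st w0 wL' r)).
  by apply: ler_wpM2l => //; exact: (ler_powRl st0 (b0 r) br).
have GN2 r : r \in G -> (r < N + N)%N by move=> /GN/andP[].
apply: (le_trans (cutoff_caccioppoli y k Gu GN2 G0 NL om0 hu)).
apply: (@le_trans _ _ ((size G)%:R^-1 * M)).
  have -> : (size G)%:R^-1 * M = (size G)%:R^-1 ^+ 2 * \sum_(r <- G) M.
    rewrite big_const_seq count_predT iter_addr_0 -[M *+ _]mulr_natr; field.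
    by rewrite pnatr_eq0 -lt0n.
  apply: ler_wpM2l; first exact: sqr_ge0.
  by rewrite big_seq [X in _ <= X]big_seq; apply: ler_sum.
have sG : (size G)%:R^-1 <= 3 / N%:R :> R.
  by rewrite ler_pdivlMr// mulrC ler_pdivrMr// ltr0n.
apply: le_trans (ler_wpM2r M0 sG) _.
rewrite le_eqVlt; apply/orP; left; apply/eqP.
rewrite /M /step_const -/C1.
rewrite powRN !powRD ?(gt_eqF NR) ?implybT// powRr1 ?ltW//.
rewrite !powRM ?mulr_ge0 ?powR_ge0 ?invr_ge0 ?(ltW s0)//.
rewrite -!powRrM !powRV ?ltW//.
have E (a1 b1 : R) : 0 < a1 -> a1 `^ b1 != 0 by move=> h; rewrite lt0r_neq0 ?powR_gt0.
field.
rewrite !E// ?lt0r_neq0//.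
Qed.

End Step.

(** * The exponents of the iteration *)

Section Iteration.
Variable R : realType.

Lemma bond_sum_le d (S : {fset site d}) (W : site d -> R) : (forall x, 0 <= W x) ->
  \sum_(e <- bonds_in S) (W (lower e) + W (upper e)) <=
  2 * d%:R * \sum_(x <- S) W x.
Proof.
move=> W0; have -> : 2 * d%:R * \sum_(x <- S) W x =
    \sum_(i < d) \sum_(x <- S) W x + \sum_(i < d) \sum_(x <- S) W x.
  by rewrite sumr_const card_ord -[_ *+ d]mulr_natl; ring.
rewrite big_split /=; apply: lerD.
  rewrite (@big_bonds_in _ _ _ (fun e => W (lower e))); apply: ler_sum => i _.
  by apply: (ler_fsum W0) => x -> _ _.
rewrite (@big_bonds_in _ _ _ (fun e => W (upper e))); apply: ler_sum => i _.
apply: (@ler_fsum_inj R _ _ _ _ _ _ (fun x => x + unit_vec i) W) => //.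
exact: addIr.
Qed.

(** The conductances are removed from the energy at the price of the exponent
    [t < 2] of the gradient. *)
Lemma gradient_norm_le (T : Type) (S : seq T) (omega g : T -> R) (q t : R) :
  0 < q -> t^-1 = (1 + q^-1) / 2 -> (forall e, 0 < omega e) ->
  (\sum_(e <- S) `|g e| `^ t) `^ (2 / t) <=
  (\sum_(e <- S) (omega e)^-1 `^ q) `^ q^-1 * \sum_(e <- S) omega e * g e ^+ 2.
Proof.
move=> q0 tE om0.
have qn0 : q != 0 by rewrite lt0r_neq0.
have q1 : 0 < q + 1 by lra.
have tE2 : t / 2 = q / (q + 1).
  by rewrite -[t]invrK tE; field; rewrite qn0; lra.
have Q0 : 0 < (q + 1) / q by rewrite divr_gt0.
have QQ : (q + 1)^-1 + ((q + 1) / q)^-1 = 1 by field; rewrite qn0; lra.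
have tE3 : q / (q + 1) * ((q + 1) / q) = 1 by field; rewrite qn0; lra.
have tE4 : t / 2 * (q + 1) = q by rewrite tE2; field; lra.
have tE5 : (q + 1)^-1 * ((q + 1) / q) = q^-1 by field; rewrite qn0; lra.
have tE6 : 2 / t = (q + 1) / q by rewrite tE; field.
set X := \sum_(e <- S) `|g e| `^ t.
set Om := \sum_(e <- S) (omega e)^-1 `^ q; set Y := \sum_(e <- S) omega e * _.
have og0 e : 0 <= omega e * g e ^+ 2 by rewrite mulr_ge0 ?sqr_ge0// ltW.
have Y0 : 0 <= Y by exact: sumr_ge0.
have X0 : 0 <= X by apply: sumr_ge0 => e _; exact: powR_ge0.
have XE : \sum_(e <- S) (omega e)^-1 `^ (t / 2) * (omega e * g e ^+ 2) `^ (t / 2) = X.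
  apply: eq_bigr => e _; rewrite -powRM ?invr_ge0 ?og0 ?(ltW (om0 _))//.
  rewrite mulrA mulVf ?mul1r ?lt0r_neq0//.
  rewrite -(real_normK (num_real (g e))) -powR_mulrn// -powRrM; congr (_ `^ _).
  by field.
have OmE : \sum_(e <- S) ((omega e)^-1 `^ (t / 2)) `^ (q + 1) = Om.
  by apply: eq_bigr => e _; rewrite -powRrM tE4.
have YE : \sum_(e <- S) ((omega e * g e ^+ 2) `^ (t / 2)) `^ ((q + 1) / q) = Y.
  by apply: eq_bigr => e _; rewrite -powRrM tE2 tE3 powRr1.
clearbody X Om Y.
have h : X <= Om `^ (q + 1)^-1 * Y `^ ((q + 1) / q)^-1.
  rewrite -XE -OmE -YE.
  exact: (@holder_sum R T S xpredT (fun e => (omega e)^-1 `^ (t / 2))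
    (fun e => (omega e * g e ^+ 2) `^ (t / 2)) _ _ q1 Q0 QQ
    (fun _ => powR_ge0 _ _) (fun _ => powR_ge0 _ _)).
rewrite tE6; apply: (le_trans (ler_powRl (ltW Q0) X0 h)).
rewrite powRM ?powR_ge0// -!powRrM mulVf ?lt0r_neq0// powRr1//.
by rewrite tE5.
Qed.

Lemma pow2D (x y : R) : 2 `^ (x + y) = 2 `^ x * 2 `^ y.
Proof. by rewrite powRD// pnatr_eq0 implybT. Qed.

Lemma pow2_nat (J k : nat) : (k <= J)%N -> (2 ^ (J - k))%:R = 2 `^ (J%:R - k%:R) :> R.
Proof. by move=> kJ; rewrite natrX -natrB// powR_mulrn. Qed.

(** The power by which the energy improves in one step. *)
Definition gain (p' s : R) := s / (2 * p').

(** One step costs the power [- radius_exp] of the width of the cutoff region. *)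
Definition radius_exp (p p' s t : R) := 1 + p^-1 + s / t / p'.

(** The power with which [(sum |nabla u| ^ t) ^ (2 / t)] scales with the radius of
    the box. *)
Definition energy_dim n (t : R) := 2 * n.+2%:R / t - 2.

(** The energies at the [j]-th scale are shown to decay like [2 ^ (- 2 * decay * j)].
    The first summand outweighs the loss in each step, the second one
    the scaling of the energy over all the steps. *)
Definition decay n (p p' s t : R) :=
  (radius_exp p p' s t + 2 * gain p' s - 2) / (2 * (gain p' s - 1)) + energy_dim n t / 2.

Lemma energy_dim_ge0 n (s t : R) : 0 < t -> 0 < s ->
  s^-1 = t^-1 - n.+1%:R^-1 -> 0 <= energy_dim n t.
Proof.
move=> t0 s0 st; have n1 : (0 : R) < n.+1%:R by rewrite ltr0n.
have : n.+1%:R^-1 <= t^-1 by rewrite -subr_ge0 -st invr_ge0 ltW.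
rewrite lef_pV2 ?posrE// => h.
rewrite /energy_dim subr_ge0 -mulrA ler_peMr//.
by rewrite ler_pdivlMr// mul1r; apply: le_trans h _; rewrite ler_nat.
Qed.

Lemma radius_exp_gt0 (p p' s t : R) : 0 < p -> 0 < p' -> 0 < s -> 0 < t -> 0 < radius_exp p p' s t.
Proof.
move=> p0 p'0 s0 t0.
by rewrite /radius_exp -addrA ltr_pwDl// addr_ge0// ?invr_ge0 ?divr_ge0// ltW.
Qed.

Lemma decay_ge n (p p' s t : R) : 1 < gain p' s -> 0 < radius_exp p p' s t -> 0 <= energy_dim n t ->
  energy_dim n t / 2 <= decay n p p' s t /\
  radius_exp p p' s t + 2 * gain p' s - 2 <= 2 * decay n p p' s t * (gain p' s - 1).
Proof.
rewrite /decay; move: (gain p' s) (radius_exp p p' s t) (energy_dim n t) => c m b c1 m0 b0.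
have T0 : 0 <= (m + 2 * c - 2) / (2 * (c - 1)) by rewrite divr_ge0; lra.
split; first by lra.
have {1}-> : m + 2 * c - 2 = 2 * ((m + 2 * c - 2) / (2 * (c - 1))) * (c - 1).
  by field; lra.
by apply: ler_wpM2r; lra.
Qed.

(** Both sides of the iteration scale in the same way with the size of the box. *)
Lemma scaling_identity n (p p' q s t : R) :
  0 < p -> 0 < p' -> p^-1 + p'^-1 = 1 -> 0 < q -> t^-1 = (1 + q^-1) / 2 ->
  0 < t -> 0 < s -> s^-1 = t^-1 - n.+1%:R^-1 ->
  n.+2%:R * (p^-1 + q^-1) - radius_exp p p' s t + gain p' s * energy_dim n t = energy_dim n t.
Proof.
move=> p0 p'0 pp' q0 tE t0 s0 st.
have tn0 := lt0r_neq0 t0; have sn0 := lt0r_neq0 s0.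
have pn0 := lt0r_neq0 p0; have p'n0 := lt0r_neq0 p'0; have qn0 := lt0r_neq0 q0.
have n1R : (n.+1%:R : R) = n%:R + 1 by rewrite -natr1.
have n2R : (n.+2%:R : R) = n%:R + 2 by rewrite -addn2 natrD.
have n1 : n%:R + 1 != 0 :> R by rewrite -n1R pnatr_eq0.
have p'E : p'^-1 = 1 - p^-1 by rewrite -pp'; ring.
have qE : q^-1 = 2 * t^-1 - 1 by rewrite tE; field.
have sE : s * (t^-1 - n.+1%:R^-1) = 1 by rewrite -st divff.
have chiE : gain p' s * (2 * (n%:R + 1) * (t^-1 - n.+1%:R^-1)) = (n%:R + 1) * p'^-1.
  rewrite /gain.
  transitivity ((s * (t^-1 - n.+1%:R^-1)) * ((n%:R + 1) * p'^-1)); last by rewrite sE mul1r.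
  by rewrite invfM; move: (t^-1 - _) => z; field.
have step : gain p' s * energy_dim n t - 2 * gain p' s * t^-1 = (n%:R + 1) * p'^-1.
  rewrite -chiE /energy_dim n1R n2R; field.
  by rewrite tn0 n1.
have muE : radius_exp p p' s t = 1 + p^-1 + 2 * gain p' s * t^-1.
  by rewrite /radius_exp /gain; field; rewrite tn0 pn0 p'n0.
have bE : energy_dim n t = n.+2%:R * (1 + q^-1) - 2 by rewrite /energy_dim qE; field.
transitivity (n.+2%:R * (p^-1 + q^-1) - 1 - p^-1 +
    (gain p' s * energy_dim n t - 2 * gain p' s * t^-1)); first by rewrite muE; ring.
by rewrite step p'E bE n2R; ring.
Qed.

(** Above the level [k'] the excess over [k] is at least [k' - k]. *)
Lemma level_gain (a k k' r s : R) : k < k' -> 0 < r -> r <= s ->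
  Num.max 0 (a - k') `^ r <= (k' - k) `^ (r - s) * Num.max 0 (a - k) `^ s.
Proof.
move=> kk' r0 rs; have s0 : 0 < s by exact: lt_le_trans rs.
case: (leP (a - k') 0) => ak'.
  by rewrite powR0 ?lt0r_neq0// mulr_ge0 ?powR_ge0.
have ak : 0 < a - k by lra.
rewrite (max_r (ltW ak)) ?(max_r (ltW ak')).
apply: (@le_trans _ _ ((a - k) `^ r)); first by apply: ler_powRl; lra.
have -> : (a - k) `^ r = (a - k) `^ (r - s) * (a - k) `^ s.
  by rewrite -powRD ?subrK// (gt_eqF ak) implybT.
apply: ler_wpM2r; first exact: powR_ge0.
rewrite -[r - s]opprB !powRN lef_pV2 ?posrE ?powR_gt0 ?subr_gt0//; last by rewrite -subr_gt0.
by apply: ler_powRl; lra.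
Qed.

(** The recursion [X -> T * C * N ^ (- m) * H ^ (2 - 2 * c) * X ^ c], with the width
    [N = 2 ^ (J - j - 2)] and the level difference [H = h * 2 ^ (- (j + 1))],
    preserves a bound that decays geometrically in [j] once [eps] is small. *)
Lemma step_arith (c m b ta T C eps h J j D X : R) :
  1 < c -> 0 <= j -> 0 < eps -> 0 < h -> 0 <= T -> 0 <= C -> 0 <= X ->
  D - m + c * b = b -> m + 2 * c - 2 <= 2 * ta * (c - 1) ->
  eps `^ (c - 1) * (T * C * 2 `^ (2 * m + 2 * c - 2 + 2 * ta)) <= 1 ->
  X <= eps * h ^+ 2 * 2 `^ (J * b - 2 * ta * j) ->
  T * 2 `^ (J * D) * (C * (2 `^ (J - j - 2)) `^ (- m) *
    (h * 2 `^ (- (j + 1))) `^ (2 - 2 * c) * X `^ c) <=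
  eps * h ^+ 2 * 2 `^ (J * b - 2 * ta * (j + 1)).
Proof.
move=> c1 j0 e0 h0 T0 C0 X0 Db tac small Xle.
have c0 : 0 <= c by lra.
have Xc : X `^ c <= eps `^ (c - 1) * (eps * (h `^ (2 * c) * 2 `^ (c * (J * b - 2 * ta * j)))).
  apply: le_trans (ler_powRl c0 X0 Xle) _.
  rewrite -(powR_mulrn 2 (ltW h0)) !powRM ?mulr_ge0 ?powR_ge0 ?(ltW e0)// -!powRrM.
  rewrite [(J * b - _) * c]mulrC.
  have cp : 0 < c by lra.
  by rewrite -(mulr_powRB1 (ltW e0) cp) [eps * _]mulrC -!mulrA.
have hh : h `^ (2 - 2 * c) * h `^ (2 * c) = h ^+ 2.
  by rewrite -powRD ?(gt_eqF h0) ?implybT// subrK powR_mulrn// ltW.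
set E := 2 * m + 2 * c - 2 + 2 * ta in small.
apply: (@le_trans _ _ (T * C * 2 `^ (J * D - m * (J - j - 2) - (j + 1) * (2 - 2 * c)
   + c * (J * b - 2 * ta * j)) * eps `^ (c - 1) * (eps * h ^+ 2))).
  have -> : (2 `^ (J - j - 2)) `^ (- m) = 2 `^ (- (m * (J - j - 2))).
    by rewrite -powRrM; congr (_ `^ _); ring.
  have -> : (h * 2 `^ (- (j + 1))) `^ (2 - 2 * c) =
      h `^ (2 - 2 * c) * 2 `^ (- ((j + 1) * (2 - 2 * c))).
    by rewrite powRM ?powR_ge0 ?(ltW h0)// -powRrM mulNr.
  rewrite !pow2D -hh.
  set P1 := 2 `^ (J * D); set P2 := 2 `^ (- (m * _)); set P3 := 2 `^ (- ((j + 1) * _)).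
  have P10 : 0 <= P1 by exact: powR_ge0.
  have P20 : 0 <= P2 by exact: powR_ge0.
  have P30 : 0 <= P3 by exact: powR_ge0.
  have H0 : 0 <= h `^ (2 - 2 * c) by exact: powR_ge0.
  have Q : 0 <= T * P1 * (C * P2 * (h `^ (2 - 2 * c) * P3)) by rewrite !mulr_ge0.
  have := ler_wpM2l Q Xc; rewrite -!mulrA => /le_trans; apply.
  by rewrite le_eqVlt; apply/orP; left; apply/eqP; ring.
have -> : J * D - m * (J - j - 2) - (j + 1) * (2 - 2 * c) + c * (J * b - 2 * ta * j) =
    (J * b - 2 * ta * (j + 1)) + (E + j * (m + 2 * c - 2 - 2 * ta * (c - 1))).
  have -> : D = b + m - c * b by lra.
  by rewrite /E; ring.
rewrite pow2D [X in _ <= X]mulrC.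
set Q := 2 `^ (J * b - _); have Q0 : 0 <= Q by exact: powR_ge0.
have eh : 0 <= eps * h ^+ 2 by rewrite mulr_ge0 ?sqr_ge0// ltW.
have le1 : eps `^ (c - 1) * (T * C * 2 `^ (E + j * (m + 2 * c - 2 - 2 * ta * (c - 1)))) <= 1.
  apply: le_trans small; apply: ler_wpM2l; first exact: powR_ge0.
  apply: ler_wpM2l; first by rewrite mulr_ge0.
  apply: ler_powR; first by rewrite ler1n.
  rewrite -lerBrDl subrr mulr_ge0_le0//; lra.
have := ler_wpM2r (mulr_ge0 Q0 eh) le1; rewrite mul1r; apply: le_trans.
by rewrite le_eqVlt; apply/orP; left; apply/eqP; ring.
Qed.

End Iteration.

(** * The bound at the centre of a box *)

Section LocalBound.
Variable R : realType.

(** The levels increase from 0 to [h]. *)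
Definition excess d (u : site d -> R) (h : R) (j : nat) (x : site d) : R :=
  Num.max 0 (u x - h * (1 - 2 `^ (- j%:R))).

(** The size at the [j]-th scale [2 ^ (J - j)] is measured for the function
    truncated at the [j]-th level and cut off between the scales [j + 1] and [j]. *)
Definition truncated_energy_le d (y : site d) (J : nat) (t : R) (u : site d -> R)
    (h : R) (j : nat) (B : R) :=
  exists eta : site d -> R, [/\ forall x, 0 <= eta x,
    forall x, (rad y x <= 2 ^ (J - j.+1))%N -> eta x = 1,
    forall x, (2 ^ (J - j.+1) + 2 ^ (J - j.+1) <= rad y x)%N -> eta x = 0 &
    (\sum_(e <- bonds_in (box y (2 ^ J)))
      `|nabla (fun x => eta x * excess u h j x) e| `^ t) `^ (2 / t) <= B].

Lemma excess_ge0 d (u : site d -> R) h j x : 0 <= excess u h j x.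
Proof. by rewrite /excess le_max lexx. Qed.

Lemma cutoff_eq1 (G : seq nat) N r : (0 < size G)%N ->
  (forall g, g \in G -> (N <= g < N + N)%N) -> (r <= N)%N -> cutoff R G r = 1.
Proof.
move=> G0 GN rN; apply: cutoff1 => //; apply/allP => g /GN/andP[Ng _].
exact: leq_trans Ng.
Qed.

Lemma cutoff_eq0 (G : seq nat) N r :
  (forall g, g \in G -> (N <= g < N + N)%N) -> (N + N <= r)%N -> cutoff R G r = 0.
Proof.
move=> GN rN; apply: cutoff0; apply/allP => g /GN/andP[_ gN].
exact: leq_trans rN.
Qed.

Lemma pow2_half J j : (j < J)%N -> (2 ^ (J - j.+1) + 2 ^ (J - j.+1))%N = (2 ^ (J - j))%N.
Proof. by move=> jJ; rewrite addnn -mul2n -expnS; congr (2 ^ _)%N; lia. Qed.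

Section Steps.
Variables (n : nat) (omega : bond n.+2 -> R) (u : site n.+2 -> R) (y : site n.+2).
Hypotheses (om0 : forall e, 0 < omega e)
  (hu : forall x, nabla_star (fun e => omega e * nabla u e) x = 0).

(** All radii are used in the first cutoff, so that its gradient is at most the
    inverse of the radius, and no Sobolev inequality is needed. *)
Lemma energy_base (J : nat) (p p' q t T A h : R) :
  0 < p -> 0 < p' -> p^-1 + p'^-1 = 1 -> 0 < q -> t^-1 = (1 + q^-1) / 2 ->
  (0 < J)%N -> 0 <= T -> 0 <= A -> 0 <= h ->
  (\sum_(e <- bonds_in (box y (2 ^ J))) omega e `^ p) `^ p^-1 *
  (\sum_(e <- bonds_in (box y (2 ^ J))) (omega e)^-1 `^ q) `^ q^-1 <=
    T * 2 `^ (J%:R * (n.+2%:R * (p^-1 + q^-1))) ->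
  \sum_(x <- box y (2 ^ J)) `|u x| `^ (2 * p') <=
    A `^ (2 * p') * 2 `^ (J%:R * n.+2%:R) ->
  truncated_energy_le y J t u h 0
    (T * (4 * (2 * n.+2%:R) `^ p'^-1) * A ^+ 2 * 2 `^ (J%:R * energy_dim n t)).
Proof.
move=> p0 p'0 pp' q0 tE J0 T0 A0 h0 hT hA.
set N := (2 ^ (J - 1))%N; pose G := iota N N.
have N0 : (0 < N)%N by rewrite expn_gt0.
have G0 : (0 < size G)%N by rewrite size_iota.
have GN r : r \in G -> (N <= r < N + N)%N by rewrite mem_iota.
have GN2 r : r \in G -> (r < N + N)%N by move=> /GN/andP[].
have NN : (N + N = 2 ^ J)%N by rewrite -[in RHS](subn0 J); exact: pow2_half.
have NL : (N + N <= 2 ^ J)%N by rewrite NN.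
have Gu : uniq G by exact: iota_uniq.
exists (fun x => cutoff R G (rad y x)); split.
- by move=> x; exact: cutoff_ge0.
- by move=> x; exact: cutoff_eq1.
- by move=> x; exact: cutoff_eq0.
set k := h * (1 - 2 `^ (- 0%:R)).
have k0 : 0 <= k by rewrite /k oppr0 powRr0 subrr mulr0.
pose v x := Num.max 0 (u x - k).
have v0 x : 0 <= v x by rewrite /v le_max lexx.
have vu x : v x <= `|u x|.
  by rewrite /v ge_max normr_ge0 /=; apply: le_trans (ler_norm _); rewrite lerBlDr lerDl.
set S := bonds_in (box y (2 ^ J)) in hT *.
set Ap := _ `^ p^-1 in hT; set Om := _ `^ q^-1 in hT.
have Om0 : 0 <= Om by exact: powR_ge0.
have ip' : 0 <= p'^-1 by rewrite invr_ge0 ltW.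
apply: (le_trans (gradient_norm_le S _ q0 tE om0)); rewrite -/Om.
have f0 e : 0 <= omega e * (v (lower e) * v (upper e)).
  by rewrite !mulr_ge0// ltW.
have := cutoff_caccioppoli y k Gu GN2 G0 NL om0 hu; rewrite -/S -/v => Y1.
have := @sum_count_le R _ _ G (S : seq _) (cross y) _ 1 f0 (fun e => count_cross y e Gu).
rewrite mul1r => Y2.
have := @holder_sum R _ (S : seq _) xpredT omega (fun e => v (lower e) * v (upper e))
  p p' p0 p'0 pp' (fun e => ltW (om0 e)) (fun e => mulr_ge0 (v0 _) (v0 _)).
rewrite -/Ap => Y3.
have Y4 : \sum_(e <- S) (v (lower e) * v (upper e)) `^ p' <=
    2 * n.+2%:R * (A `^ (2 * p') * 2 `^ (J%:R * n.+2%:R)).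
  apply: le_trans (ler_sum _ (fun e _ => mulr_powR_le (v0 _) (v0 _) (ltW p'0))) _.
  apply: (le_trans (@bond_sum_le R _ (box y (2 ^ J)) (fun x => v x `^ (2 * p')) (fun x => powR_ge0 _ _))).
  apply: ler_wpM2l; first by rewrite mulr_ge0.
  apply: le_trans hA; apply: ler_sum => x _; apply: ler_powRl => //.
  by rewrite mulr_ge0// ltW.
have Y4' := ler_powRl ip' (sumr_ge0 _ (fun e _ => powR_ge0 _ _)) Y4.
have Ap0 : 0 <= Ap by exact: powR_ge0.
have Y5 := le_trans Y2 (le_trans Y3 (ler_wpM2l Ap0 Y4')).
have Y6 := le_trans Y1 (ler_wpM2l (sqr_ge0 _) Y5).
apply: le_trans (ler_wpM2l Om0 Y6) _.
have -> : (2 * n.+2%:R * (A `^ (2 * p') * 2 `^ (J%:R * n.+2%:R))) `^ p'^-1 =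
    (2 * n.+2%:R) `^ p'^-1 * A ^+ 2 * 2 `^ (J%:R * n.+2%:R * p'^-1).
  rewrite !powRM ?mulr_ge0 ?powR_ge0// -!powRrM mulfK ?lt0r_neq0//.
  by rewrite powR_mulrn// !mulrA.
have -> : ((size G)%:R^-1 : R) = 2 `^ (1 - J%:R).
  by rewrite size_iota pow2_nat// -powRN opprB.
have -> : (2 `^ (1 - J%:R) : R) ^+ 2 = 4 * 2 `^ (J%:R * (- 2)).
  rewrite pow2D powRr1// exprMn -[_ `^ _ ^+ 2]powR_mulrn ?powR_ge0// -powRrM.
  by congr (_ * _ `^ _); ring.
have -> : J%:R * energy_dim n t = J%:R * (n.+2%:R * (p^-1 + q^-1)) +
   (J%:R * n.+2%:R * p'^-1 + J%:R * (-2)).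
  rewrite /energy_dim -[_ / t]mulrA tE (_ : p'^-1 = 1 - p^-1); last by rewrite -pp'; ring.
  by field; rewrite !lt0r_neq0.
rewrite !pow2D.
move: hT; set P1 := 2 `^ (J%:R * (n.+2%:R * _)); set P2 := 2 `^ _; set P3 := 2 `^ _.
set c := (2 * n.+2%:R) `^ p'^-1 => hT.
have Q0 : 0 <= 4 * c * A ^+ 2 * P3 * P2 by rewrite !mulr_ge0 ?powR_ge0 ?sqr_ge0.
have := ler_wpM2l Q0 hT; clearbody P1 P2 P3 c Ap Om.
have -> : 4 * c * A ^+ 2 * P3 * P2 * (Ap * Om) =
  Om * (4 * P2 * (Ap * (c * A ^+ 2 * P3))) by ring.
by have -> : 4 * c * A ^+ 2 * P3 * P2 * (T * P1) =
  T * (4 * c) * A ^+ 2 * (P1 * (P3 * P2)) by ring.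
Qed.

Lemma energy_next (J j : nat) (p p' q s t T h eps : R) :
  (0 < n)%N ->
  0 < p -> 0 < p' -> p^-1 + p'^-1 = 1 -> 0 < q -> t^-1 = (1 + q^-1) / 2 ->
  1 < t -> 0 < s -> s^-1 = t^-1 - n.+1%:R^-1 -> 2 * p' < s ->
  (j.+1 < J)%N -> 0 <= T -> 0 < h -> 0 < eps ->
  (\sum_(e <- bonds_in (box y (2 ^ J))) omega e `^ p) `^ p^-1 *
  (\sum_(e <- bonds_in (box y (2 ^ J))) (omega e)^-1 `^ q) `^ q^-1 <=
    T * 2 `^ (J%:R * (n.+2%:R * (p^-1 + q^-1))) ->
  eps `^ (gain p' s - 1) * (T * step_const n p p' s t *
    2 `^ (2 * radius_exp p p' s t + 2 * gain p' s - 2 + 2 * decay n p p' s t)) <= 1 ->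
  truncated_energy_le y J t u h j
    (eps * h ^+ 2 * 2 `^ (J%:R * energy_dim n t - 2 * decay n p p' s t * j%:R)) ->
  truncated_energy_le y J t u h j.+1
    (eps * h ^+ 2 * 2 `^ (J%:R * energy_dim n t - 2 * decay n p p' s t * j.+1%:R)).
Proof.
move=> n0 p0 p'0 pp' q0 tE t1 s0 st sp jJ T0 h0 eps0 hT small [eta [eta0 eta1 etaL etaE]].
have t0 : 0 < t := lt_trans ltr01 t1.
have c1 : 1 < gain p' s by rewrite /gain ltr_pdivlMr ?mul1r// mulr_gt0.
have m0 := radius_exp_gt0 p0 p'0 s0 t0; have b0 := energy_dim_ge0 t0 s0 st.
have [ta1 ta2] := decay_ge c1 m0 b0.
set N := (2 ^ (J - j.+2))%N.
have N0 : (0 < N)%N by rewrite expn_gt0.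
have NN : (N + N = 2 ^ (J - j.+1))%N by exact: pow2_half.
have NL : (N + N <= 2 ^ J)%N by rewrite NN leq_exp2l// leq_subr.
have N2 : (2 ^ (J - j.+1) + 2 ^ (J - j.+1) = 2 ^ (J - j))%N by apply: pow2_half; exact: ltnW.
pose w x := eta x * excess u h j x.
have w0 x : 0 <= w x by rewrite mulr_ge0 ?excess_ge0.
pose L' := (2 ^ (J - j)).-1.
have L'E : L'.+1 = (2 ^ (J - j))%N by rewrite /L' prednK// expn_gt0.
have L'L : (L' < 2 ^ J)%N by rewrite L'E leq_exp2l// leq_subr.
have wL' x : x \notin box y L' -> w x = 0.
  by rewrite mem_box -ltnNge => xL; rewrite /w etaL ?mul0r// N2 -L'E.
set D := 2 `^ (- (j%:R + 1)) : R.
have D0 : 0 < D by exact: powR_gt0.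
have DE : 2 `^ (- j%:R) = 2 * D :> R.
  rewrite /D [in LHS](_ : - j%:R = 1 + - (j%:R + 1)); last by ring.
  by rewrite pow2D powRr1.
pose k := h * (1 - 2 `^ (- j.+1%:R)); pose H := (h * D) `^ (2 * p' - s).
have kk : k - h * (1 - 2 `^ (- j%:R)) = h * D.
  by rewrite /k DE -[j.+1%:R]natr1 -/D; ring.
have H0 : 0 <= H by exact: powR_ge0.
have vw x : (rad y x <= N + N)%N -> Num.max 0 (u x - k) `^ (2 * p') <= H * w x `^ s.
  move=> xN; rewrite /w eta1 ?mul1r; last by rewrite -NN.
  rewrite /H -kk; apply: level_gain; rewrite ?mulr_gt0//; last exact: ltW.
  by rewrite -subr_gt0 kk mulr_gt0.
have [G [G0 GN]] := energy_step n0 N0 NL L'L p0 p'0 pp' t1 s0 st H0 om0 hu w0 wL' vw.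
set S := bonds_in (box y (2 ^ J)) in hT etaE *.
set Ap := (\sum_(e <- S) omega e `^ p) `^ p^-1 in hT *.
set Om := _ `^ q^-1 in hT; set SC := step_const n p p' s t in small *.
have Om0 : 0 <= Om by exact: powR_ge0.
move=> Y1; exists (fun x => cutoff R G (rad y x)); split.
- by move=> x; exact: cutoff_ge0.
- by move=> x; exact: cutoff_eq1.
- by move=> x; exact: cutoff_eq0.
apply: (le_trans (gradient_norm_le S _ q0 tE om0)); rewrite -/Om.
apply: le_trans (ler_wpM2l Om0 Y1) _.
have SC0 : 0 <= SC.
  by rewrite /SC /step_const !mulr_ge0 ?powR_ge0.
set X := \sum_(e <- S) _ in etaE *.
have X0 : 0 <= X by apply: sumr_ge0 => e _; exact: powR_ge0.
have := step_arith c1 (ler0n R j) eps0 h0 T0 SC0 (powR_ge0 X (2 / t))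
  (scaling_identity p0 p'0 pp' q0 tE t0 s0 st) ta2 small etaE.
rewrite -[j.+1%:R]natr1; apply: le_trans.
have -> : (X `^ (2 / t)) `^ gain p' s = X `^ (s / t / p').
  by rewrite -powRrM /gain; congr (_ `^ _); field; rewrite !lt0r_neq0.
have -> : N%:R = 2 `^ (J%:R - j%:R - 2) :> R.
  by rewrite /N pow2_nat// -[j.+2]addn2 natrD opprD addrA.
have -> : H `^ p'^-1 = (h * 2 `^ (- (j%:R + 1))) `^ (2 - 2 * gain p' s).
  by rewrite /H -/D -powRrM /gain; congr (_ `^ _); field; rewrite !lt0r_neq0.
rewrite -/(radius_exp p p' s t).
set P1 := 2 `^ (J%:R * _) in hT *; set P2 := (2 `^ (J%:R - _ - 2)) `^ _.
set P3 := (h * _) `^ _; set P4 := X `^ _.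
have Q0 : 0 <= SC * P2 * P3 * P4 by rewrite !mulr_ge0 ?powR_ge0.
have := ler_wpM2l Q0 hT; clearbody P1 P2 P3 P4 Ap Om SC.
have -> : Om * (SC * P2 * Ap * P3 * P4) = SC * P2 * P3 * P4 * (Ap * Om) by ring.
by rewrite [T * P1 * _]mulrC.
Qed.

(** At the last scale the truncated function vanishes outside the unit box, so its
    value at [y] is determined by two increments. *)
Lemma energy_end (J : nat) (t h K : R) : (0 < J)%N -> 0 < t -> 0 <= h -> 0 <= K ->
  truncated_energy_le y J t u h J.-1 ((h * K) ^+ 2) ->
  u y <= h * (1 + 2 * K).
Proof.
case: J => // J _ t0 h0 K0 [eta [eta0]]; rewrite /= subnn expn0 => eta1 eta2 etaE.
set S := bonds_in (box y (2 ^ J.+1)) in etaE.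
pose w x := eta x * excess u h J x.
have grad e : e \in S -> `|nabla w e| <= h * K.
  move=> eS; have hK : 0 <= h * K by exact: mulr_ge0.
  rewrite -(@ler_pXn2r _ 2)// ?nnegrE//; apply: le_trans etaE.
  have -> : `|nabla w e| ^+ 2 = (`|nabla w e| `^ t) `^ (2 / t).
    rewrite -powRrM -powR_mulrn//; congr (_ `^ _); field; exact: lt0r_neq0.
  apply: ler_powRl; first by rewrite divr_ge0// ltW.
    exact: powR_ge0.
  rewrite (big_fsetD1 e)//= lerDl; apply: sumr_ge0 => x _; exact: powR_ge0.
pose i : 'I_n.+2 := ord0; pose e1 : bond n.+2 := (y, i).
pose e2 : bond n.+2 := (y + unit_vec i, i).
have rady : rad y y = 0%N.
  by apply/eqP; rewrite -leqn0; apply/bigmax_leqP => k _; rewrite subrr.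
have r1 := rad_upper y y i; have r2 := rad_upper y (y + unit_vec i) i.
have r3 := rad_coord y (y + unit_vec i + unit_vec i) i.
have L2 : (2 <= 2 ^ J.+1)%N by rewrite expnS leq_pmulr// expn_gt0.
have e1S : e1 \in S by rewrite in_bonds_in !mem_box /lower /upper /=; lia.
have e2S : e2 \in S by rewrite in_bonds_in !mem_box /lower /upper /=; lia.
have w2 : w (y + unit_vec i + unit_vec i) = 0.
  rewrite /w eta2 ?mul0r//; apply: leq_trans r3.
  suff -> : (y + unit_vec i + unit_vec i) 0 i - y 0 i = 2 by [].
  by rewrite mxE [(y + _) 0 i]mxE !unit_vecE eqxx mulr1n; ring.
have wy : w y = excess u h J y by rewrite /w eta1 ?mul1r// rady.
have := grad _ e1S; have := grad _ e2S.
rewrite /nabla /e1 /e2 /lower /upper /= w2 wy.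
set a := w _; set b := excess _ _ _ _ => h2 h1.
have b2 : b <= 2 * (h * K).
  move: h1 h2; rewrite !ler_norml => /andP[h1 _] /andP[h2 _]; lra.
have : u y - h * (1 - 2 `^ (- J%:R)) <= b by rewrite /b /excess le_max lexx orbT.
have := mulr_ge0 h0 (powR_ge0 2 (- J%:R)); lra.
Qed.

End Steps.

Lemma last_exponent_le (j b ta : R) : 0 <= j -> b / 2 <= ta ->
  (j + 1) * b - 2 * ta * j <= 2 * ta.
Proof. by move=> j0 bta; nra. Qed.

(** In the proof [eps] is chosen such that one step reproduces the bound on the
    energy at the next scale, and then [h] such that the first scale satisfies it. *)
Lemma center_bound n (p p' q s t : R) :
  (0 < n)%N ->
  0 < p -> 0 < p' -> p^-1 + p'^-1 = 1 -> 0 < q -> t^-1 = (1 + q^-1) / 2 ->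
  1 < t -> 0 < s -> s^-1 = t^-1 - n.+1%:R^-1 -> 2 * p' < s ->
  exists C : R, 0 < C /\
  forall (omega : bond n.+2 -> R) (u : site n.+2 -> R) (y : site n.+2)
    (J : nat) (T A : R),
  (forall e, 0 < omega e) ->
  (forall x, nabla_star (fun e => omega e * nabla u e) x = 0) ->
  (0 < J)%N -> 1 <= T -> 0 < A ->
  (\sum_(e <- bonds_in (box y (2 ^ J))) omega e `^ p) `^ p^-1 *
  (\sum_(e <- bonds_in (box y (2 ^ J))) (omega e)^-1 `^ q) `^ q^-1 <=
    T * 2 `^ (J%:R * (n.+2%:R * (p^-1 + q^-1))) ->
  \sum_(x <- box y (2 ^ J)) `|u x| `^ (2 * p') <=
    A `^ (2 * p') * 2 `^ (J%:R * n.+2%:R) ->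
  u y <= C * T `^ (gain p' s / (2 * (gain p' s - 1))) * A.
Proof.
move=> n0 p0 p'0 pp' q0 tE t1 s0 st sp.
have t0 : 0 < t := lt_trans ltr01 t1.
have c1 : 1 < gain p' s by rewrite /gain ltr_pdivlMr ?mul1r// mulr_gt0.
have m0 := radius_exp_gt0 p0 p'0 s0 t0; have b0 := energy_dim_ge0 t0 s0 st.
have [ta1 ta2] := decay_ge c1 m0 b0.
set c := gain p' s in c1 ta1 ta2 *; set ta := decay n p p' s t in ta1 ta2 *.
have ta0 : 0 <= ta by apply: le_trans ta1; rewrite divr_ge0.
set E := 2 * radius_exp p p' s t + 2 * c - 2 + 2 * ta.
have E0 : 0 <= E by rewrite /E; lra.
pose SC := step_const n p p' s t + 1; pose K : R := 2 `^ ta.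
have sc0 : 0 <= step_const n p p' s t.
  by rewrite /step_const !mulr_ge0 ?powR_ge0.
have SC1 : 1 <= SC by rewrite /SC lerDr.
pose C0 : R := 4 * (2 * n.+2%:R) `^ p'^-1.
have C00 : 0 < C0 by rewrite mulr_gt0// powR_gt0// mulr_gt0// ltr0n.
have c'0 : 0 < c - 1 by lra.
have K0 : 0 < K by exact: powR_gt0.
have E1 : 1 <= 2 `^ E :> R by rewrite powR_ge1// ler1n.
have SE0 : 0 < SC * 2 `^ E by rewrite mulr_gt0 ?powR_gt0//; lra.
exists ((1 + 2 * K) * (C0 `^ 2^-1 * (SC * 2 `^ E) `^ ((c - 1)^-1 / 2))); split.
  by rewrite !mulr_gt0 ?powR_gt0//; lra.
move=> omega u y J T A om0 hu J0 T1 A0 hT hA.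
have T0 : 0 < T := lt_le_trans ltr01 T1.
set F := T * SC * 2 `^ E.
have F1 : 1 <= F by rewrite /F -!mulrA mulr_ege1// mulr_ege1.
have F0 : 0 < F := lt_le_trans ltr01 F1.
pose eps := F `^ (- (c - 1)^-1).
have eps0 : 0 < eps by exact: powR_gt0.
have eps1 : eps <= 1.
  by rewrite /eps powRN invf_le1 ?powR_gt0// powR_ge1// invr_ge0 ltW.
have epsF : eps `^ (c - 1) * F = 1.
  rewrite /eps -powRrM mulNr mulVf ?lt0r_neq0// powR_inv1 ?(ltW F0)//.
  by rewrite mulVf// lt0r_neq0.
pose h := (T * C0 / eps) `^ 2^-1 * A.
have TC0 : 0 < T * C0 / eps by rewrite divr_gt0// mulr_gt0.
have h0 : 0 < h by rewrite mulr_gt0// powR_gt0.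
have hE : eps * h ^+ 2 = T * C0 * A ^+ 2.
  rewrite /h exprMn -[_ `^ _ ^+ 2]powR_mulrn ?powR_ge0// -powRrM mulVf ?pnatr_eq0//.
  by rewrite powRr1 ?(ltW TC0)//; field; exact: lt0r_neq0.
have small : eps `^ (c - 1) * (T * step_const n p p' s t * 2 `^ E) <= 1.
  rewrite -[X in _ <= X]epsF; apply: ler_wpM2l; first exact: powR_ge0.
  apply: ler_wpM2r; first exact: powR_ge0.
  by apply: ler_wpM2l; [exact: ltW | rewrite /SC lerDl].
have P j : (j < J)%N -> truncated_energy_le y J t u h j
    (eps * h ^+ 2 * 2 `^ (J%:R * energy_dim n t - 2 * ta * j%:R)).
  elim: j => [_|j IH jJ].
    rewrite mulr0 subr0 hE.
    exact (energy_base om0 hu p0 p'0 pp' q0 tE J0 (ltW T0) (ltW A0) (ltW h0) hT hA).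
  apply: (energy_next om0 hu n0 p0 p'0 pp' q0 tE t1 s0 st sp jJ (ltW T0) h0 eps0 hT small).
  exact/IH/ltnW.
have PJ : truncated_energy_le y J t u h J.-1 ((h * K) ^+ 2).
  have JJ : (J.-1 < J)%N by rewrite prednK.
  have [eta [e1 e2 e3 e4]] := P _ JJ.
  exists eta; split => //; apply: (le_trans e4).
  have JE : J%:R = J.-1%:R + 1 :> R by rewrite natr1 prednK.
  have -> : (h * K) ^+ 2 = h ^+ 2 * 2 `^ (2 * ta).
    by rewrite exprMn -(powR_mulrn 2 (ltW K0)) -powRrM [ta * _]mulrC.
  rewrite -[X in _ <= X]mul1r -mulrA.
  apply: ler_pM (ltW eps0) (mulr_ge0 (sqr_ge0 _) (powR_ge0 _ _)) eps1 _.
  apply: ler_wpM2l; first exact: sqr_ge0.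
  apply: ler_powR; first by rewrite ler1n.
  by rewrite JE; exact: (last_exponent_le (ler0n R J.-1) ta1).
apply: (le_trans (energy_end J0 t0 (ltW h0) (ltW K0) PJ)).
rewrite /h le_eqVlt; apply/orP; left; apply/eqP.
have -> : T * C0 / eps = T * C0 * F `^ (c - 1)^-1.
  by rewrite /eps powRN invrK.
have -> : F = T * (SC * 2 `^ E) by rewrite /F mulrA.
rewrite !powRM ?mulr_ge0 ?powR_ge0 ?(ltW T0) ?(ltW C00) ?(ltW SE0) ?(ltW (lt_le_trans ltr01 SC1))//.
have -> : T `^ (c / (2 * (c - 1))) = T `^ 2^-1 * T `^ ((c - 1)^-1 / 2).
  rewrite -powRD; last by rewrite (gt_eqF T0) implybT.
  congr (_ `^ _); field; exact: lt0r_neq0.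
rewrite -!powRrM; ring.
Qed.

End LocalBound.

(** * From the mean of a power to the mean *)

Section MeanBound.
Variable R : realType.

(** Hoelder's inequality for the constant 1 written as a product of a positive
    and a negative power of [omega]. *)
Lemma avg_duality (K : choiceType) (S : {fset K}) (omega : K -> R) (p q : R) :
  0 < p -> 0 < q -> (0 < #|` S|)%N -> (forall e, 0 < omega e) ->
  1 <= ((#|` S|%:R)^-1 * \sum_(e <- S) omega e `^ p) `^ p^-1 *
       ((#|` S|%:R)^-1 * \sum_(e <- S) (omega e)^-1 `^ q) `^ q^-1.
Proof.
move=> p0 q0 S0 om0.
have N0 : 0 < #|` S|%:R :> R by rewrite ltr0n.
pose a := p^-1 + q^-1.
have a0 : 0 < a by rewrite addr_gt0// invr_gt0.
have P0 : 0 < p * a by exact: mulr_gt0.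
have Q0 : 0 < q * a by exact: mulr_gt0.
have PQ : (p * a)^-1 + (q * a)^-1 = 1.
  by rewrite !invfM -mulrDl -/a divff// lt0r_neq0.
set A := \sum_(e <- S) omega e `^ p; set B := \sum_(e <- S) (omega e)^-1 `^ q.
have E r (f : K -> R) : \sum_(e <- S) (f e `^ a^-1) `^ (r * a) = \sum_(e <- S) f e `^ r.
  by apply: eq_bigr => e _; rewrite -powRrM mulrCA mulVf ?mulr1// lt0r_neq0.
have EA : \sum_(e <- S) (omega e `^ a^-1) `^ (p * a) = A by exact: E.
have EB : \sum_(e <- S) ((omega e)^-1 `^ a^-1) `^ (q * a) = B by exact: E.
have EN : \sum_(e <- S) omega e `^ a^-1 * (omega e)^-1 `^ a^-1 = #|` S|%:R.
  rewrite (eq_bigr (fun=> 1)); first by rewrite big_const_seq count_predT iter_addr_0.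
  move=> e _; rewrite powRV ?divff//; last exact: ltW.
  by rewrite lt0r_neq0// powR_gt0.
have A0 : 0 <= A by apply: sumr_ge0 => e _; exact: powR_ge0.
have B0 : 0 <= B by apply: sumr_ge0 => e _; exact: powR_ge0.
clearbody A B.
have h : #|` S|%:R <= A `^ (p * a)^-1 * B `^ (q * a)^-1.
  rewrite -EA -EB -EN.
  exact (holder_sum (S : seq K) xpredT P0 Q0 PQ
    (fun _ => powR_ge0 _ _) (fun _ => powR_ge0 _ _)).
set N := #|` S|%:R in N0 h *; clearbody N.
have NV0 : 0 <= N^-1 by rewrite invr_ge0 ltW.
set L := _ * _; have L0 : 0 <= L by rewrite /L mulr_ge0 ?powR_ge0.
have La : 1 <= L `^ a^-1.
  rewrite /L powRM ?powR_ge0// -!powRrM -!invfM powRM ?NV0// powRM ?NV0// mulrACA.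
  rewrite -powRD ?PQ; last by rewrite oner_eq0.
  by rewrite powRr1// mulrC ler_pdivlMr// mul1r.
by have := ler_powRl (ltW a0) ler01 La; rewrite powR1 powRVK// lt0r_neq0.
Qed.

Lemma seq_argmax (K : eqType) (l : seq K) (f : K -> R) : l != [::] ->
  exists2 x, x \in l & forall z, z \in l -> f z <= f x.
Proof.
elim: l => // a [_ _|b l IH _]; first by exists a; rewrite ?mem_head// => z; rewrite inE => /eqP ->.
have [//|x xl xmax] := IH _; have [fa|fa] := leP (f a) (f x).
  exists x; first by rewrite inE xl orbT.
  by move=> z; rewrite inE => /orP[/eqP ->//|]; exact: xmax.
exists a; first exact: mem_head.
move=> z; rewrite inE => /orP[/eqP ->//|zl].
exact: le_trans (xmax z zl) (ltW fa).
Qed.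

Lemma nabla_star_opp d (omega : bond d -> R) (u : site d -> R) x :
  nabla_star (fun e => omega e * nabla u e) x = 0 ->
  nabla_star (fun e => omega e * nabla (fun z => - u z) e) x = 0.
Proof.
move=> hu; rewrite -[RHS]oppr0 -hu /nabla_star -sumrN; apply: eq_bigr => i _.
by rewrite /nabla; ring.
Qed.

Lemma card_bonds_in_le d (S : {fset site d}) :
  #|` bonds_in S|%:R <= d%:R * #|` S|%:R :> R.
Proof.
have h0 : 0 <= 2^-1 :> R by rewrite invr_ge0.
have := @bond_sum_le R d S (fun=> 2^-1) (fun=> h0).
have -> : 2^-1 + 2^-1 = 1 :> R by field.
rewrite !big_const_seq !count_predT !iter_addr_0.
by rewrite -[2^-1 *+ _]mulr_natr (_ : 2 * _ * _ = d%:R * #|` S|%:R)//; field.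
Qed.

(** If [|u|] is at most [G] times its value at the centre, the sum of
    [|u| ^ (2 p')] is at most [(G |u x0|) ^ (2 p' - 1)] times the sum of [|u|]; in
    the bound at the centre the excess power of [|u x0|] then cancels. *)
Lemma center_bound_mean n (C T S1 G p' kap : R) (J : nat)
    (omega : bond n.+2 -> R) (u : site n.+2 -> R) (x0 : site n.+2) :
  (forall (u : site n.+2 -> R) (A : R),
    (forall x, nabla_star (fun e => omega e * nabla u e) x = 0) -> 0 < A ->
    \sum_(x <- box x0 (2 ^ J)) `|u x| `^ (2 * p') <=
      A `^ (2 * p') * 2 `^ (J%:R * n.+2%:R) -> u x0 <= C * T `^ kap * A) ->
  0 < C -> 0 <= T -> 0 < G -> 0 < S1 -> 1 < 2 * p' ->
  (forall x, nabla_star (fun e => omega e * nabla u e) x = 0) -> 0 < `|u x0| ->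
  (forall z, z \in box x0 (2 ^ J) -> `|u z| <= G * `|u x0|) ->
  \sum_(x <- box x0 (2 ^ J)) `|u x| <= S1 ->
  `|u x0| <= C `^ (2 * p') * T `^ (2 * p' * kap) * G `^ (2 * p' - 1) *
    (S1 / 2 `^ (J%:R * n.+2%:R)).
Proof.
move=> center C0 T0 G0 S10 p1 hu a0 uG uS1.
set a := `|u x0| in a0 uG *; set r := 2 * p' in p1 center *.
set m := 2 `^ _ in center *; have m0 : 0 < m by exact: powR_gt0.
have r0 : 0 < r := lt_trans ltr01 p1.
have r1 : 0 <= r - 1 by rewrite subr_ge0 ltW.
pose B := (G * a) `^ (r - 1) * (S1 / m).
have B0 : 0 < B by rewrite mulr_gt0 ?powR_gt0 ?mulr_gt0// invr_gt0.
pose A := B `^ r^-1; have A0 : 0 < A by exact: powR_gt0.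
have Ar : A `^ r = B by rewrite /A powRVK ?(ltW B0)// lt0r_neq0.
have sumA : \sum_(x <- box x0 (2 ^ J)) `|u x| `^ r <= A `^ r * m.
  rewrite Ar /B -mulrA divfK ?lt0r_neq0//.
  apply: (@le_trans _ _ (\sum_(x <- box x0 (2 ^ J)) (G * a) `^ (r - 1) * `|u x|)).
    rewrite big_seq [X in _ <= X]big_seq; apply: ler_sum => x xB.
    rewrite -(mulr_powRB1 (normr_ge0 _) r0) mulrC; apply: ler_wpM2r => //.
    by apply: ler_powRl => //; exact: uG.
  by rewrite -mulr_sumr; apply: ler_wpM2l => //; exact: powR_ge0.
have aA : a <= C * T `^ kap * A.
  have h1 := center u A hu A0 sumA.
  have h2 : - u x0 <= C * T `^ kap * A.
    apply: (center (fun z => - u z)) => //; first by move=> x; exact: nabla_star_opp.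
    by under eq_bigr do rewrite normrN.
  by rewrite /a ler_norml h1 andbT lerNl.
have := ler_powRl (ltW r0) (ltW a0) aA.
rewrite !powRM ?mulr_ge0 ?powR_ge0 ?(ltW C0) ?(ltW A0)// Ar -powRrM [kap * r]mulrC.
rewrite /B powRM ?(ltW G0) ?(ltW a0)// -(mulr_powRB1 (ltW a0) r0).
set ar := a `^ (r - 1); have ar0 : 0 < ar by exact: powR_gt0.
set X := C `^ r; set Y := T `^ _; set Z := G `^ _; set W := S1 / m.
have -> : X * Y * (Z * ar * W) = X * Y * Z * W * ar by ring.
by rewrite ler_pM2r.
Qed.

Lemma rad_triangle d (y x z : site d) : (rad y z <= rad y x + rad x z)%N.
Proof.
apply/bigmax_leqP => k _.
have := rad_coord y x k; have := rad_coord x z k; lia.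
Qed.

Lemma site_norm1 d (u : site d -> R) S :
  site_norm 1%:E u S = (#|` S|%:R)^-1 * \sum_(x <- S) `|u x|.
Proof.
rewrite /site_norm /avg_norm; under eq_bigr do rewrite powRr1//.
by rewrite invr1 powRr1// mulr_ge0 ?invr_ge0// sumr_ge0.
Qed.

Lemma bonds_nonempty d (y : site d) N : (0 < d)%N -> (0 < N)%N ->
  (0 < #|` bonds_in (box y N)|)%N.
Proof.
case: d y => // d y _ N0; rewrite cardfs_gt0; apply/fset0Pn.
exists (y, ord0); rewrite in_bonds_in !mem_box /lower /upper /=.
have r0 : rad y y = 0%N by apply/eqP; rewrite -leqn0; apply/bigmax_leqP => k _; rewrite subrr.
by have := rad_upper y y ord0; rewrite r0; lia.
Qed.

Lemma avg_norm_fin (K : choiceType) (r : R) (f : K -> R) (S : {fset K}) :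
  (forall x, 0 <= f x) ->
  avg_norm r%:E f S = ((#|` S|%:R)^-1 * \sum_(a <- S) f a `^ r) `^ r^-1.
Proof.
by move=> f0; rewrite /avg_norm; under eq_bigr do rewrite ger0_norm//.
Qed.

Section FiniteLambda.
Variables (d : nat) (p q : R) (omega : bond d -> R) (S : {fset site d}).
Hypotheses (p0 : 0 < p) (q0 : 0 < q) (om0 : forall e, 0 < omega e)
  (S0 : (0 < #|` bonds_in S|)%N).

Lemma LambdaE : Lambda p%:E q%:E omega S =
  ((#|` bonds_in S|%:R)^-1 * \sum_(e <- bonds_in S) omega e `^ p) `^ p^-1 *
  ((#|` bonds_in S|%:R)^-1 * \sum_(e <- bonds_in S) (omega e)^-1 `^ q) `^ q^-1.
Proof.
by rewrite /Lambda /bond_norm !avg_norm_fin// => e; rewrite ?invr_ge0 ltW.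
Qed.

Lemma Lambda_ge1 : 1 <= Lambda p%:E q%:E omega S.
Proof. by rewrite LambdaE; exact: avg_duality. Qed.

Lemma sums_Lambda :
  (\sum_(e <- bonds_in S) omega e `^ p) `^ p^-1 *
  (\sum_(e <- bonds_in S) (omega e)^-1 `^ q) `^ q^-1 =
  Lambda p%:E q%:E omega S * #|` bonds_in S|%:R `^ (p^-1 + q^-1).
Proof.
have N0 : 0 < #|` bonds_in S|%:R :> R by rewrite ltr0n.
rewrite LambdaE powRD; last by rewrite (gt_eqF N0) implybT.
set A := \sum_(e <- bonds_in S) omega e `^ p.
set B := \sum_(e <- bonds_in S) (omega e)^-1 `^ q.
have A0 : 0 <= A by apply: sumr_ge0 => e _; exact: powR_ge0.
have B0 : 0 <= B by apply: sumr_ge0 => e _; exact: powR_ge0.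
clearbody A B; move: N0; set N := _%:R => N0; clearbody N.
rewrite mulrACA -!powRM ?mulr_ge0 ?invr_ge0 ?(ltW N0)//.
have E x : N^-1 * x * N = x by rewrite mulrAC mulVf ?mul1r// lt0r_neq0.
by rewrite !E.
Qed.

End FiniteLambda.

Lemma sums_Lambda_le d (p q : R) (omega : bond d -> R) (S S' : {fset site d}) :
  0 < p -> 0 < q -> (forall e, 0 < omega e) -> (0 < #|` bonds_in S|)%N ->
  {subset S' <= S} ->
  (\sum_(e <- bonds_in S') omega e `^ p) `^ p^-1 *
  (\sum_(e <- bonds_in S') (omega e)^-1 `^ q) `^ q^-1 <=
  Lambda p%:E q%:E omega S * (d%:R * #|` S|%:R) `^ (p^-1 + q^-1).
Proof.
move=> p0 q0 om0 S0 SS.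
have ip : 0 <= p^-1 by rewrite invr_ge0 ltW.
have iq : 0 <= q^-1 by rewrite invr_ge0 ltW.
have sub (f : bond d -> R) : (forall e, 0 <= f e) ->
    \sum_(e <- bonds_in S') f e <= \sum_(e <- bonds_in S) f e.
  move=> f0; apply: (ler_fsum f0) => e; rewrite !in_bonds_in andbT.
  by move=> /andP[/SS -> /SS ->].
have L0 : 0 <= Lambda p%:E q%:E omega S by exact: le_trans ler01 (Lambda_ge1 p0 q0 om0 S0).
apply: (@le_trans _ _ (Lambda p%:E q%:E omega S * #|` bonds_in S|%:R `^ (p^-1 + q^-1))).
  rewrite -sums_Lambda//; apply: ler_pM (powR_ge0 _ _) (powR_ge0 _ _) _ _.
    apply: (ler_powRl ip); first by apply: sumr_ge0 => e _; exact: powR_ge0.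
    by apply: sub => e; exact: powR_ge0.
  apply: (ler_powRl iq); first by apply: sumr_ge0 => e _; exact: powR_ge0.
  by apply: sub => e; exact: powR_ge0.
apply: (ler_wpM2l L0); apply: ler_powRl; rewrite ?ler0n ?addr_ge0//.
exact: card_bonds_in_le.
Qed.

Lemma card_box_le d (y : site d) V : (0 < V)%N ->
  #|` box y V|%:R <= (3 * V%:R) `^ d%:R :> R.
Proof.
move=> V0; rewrite card_box powR_mulrn ?mulr_ge0// natrX.
have h : (V.*2.+1 <= 3 * V)%N by lia.
by apply: lerXn2r; rewrite ?nnegrE ?mulr_ge0// -natrM ler_nat.
Qed.

Lemma dyadic_radius (D : nat) : (4 <= D)%N ->
  exists J, [/\ 0 < J, 2 ^ J + 2 ^ J <= D & D <= 4 * 2 ^ J]%N.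
Proof.
move=> D4; have D2 : (2 <= D %/ 2)%N by rewrite leq_divRL.
have /andP[J1 J2] : (2 ^ trunc_log 2 (D %/ 2) <= D %/ 2 < 2 ^ (trunc_log 2 (D %/ 2)).+1)%N.
  by apply: trunc_log_bounds => //; exact: ltnW.
exists (trunc_log 2 (D %/ 2)); rewrite expnS in J2; split; [by rewrite trunc_log_gt0|lia|lia].
Qed.

Lemma dyadic_radius_facts (V r J : nat) : (2 ^ J + 2 ^ J <= V - r)%N ->
  [/\ (r + 2 ^ J <= V)%N, (2 ^ J <= 3 * V)%N &
    forall r0 rz : nat, (rz <= r + r0)%N -> (r0 <= 2 ^ J)%N ->
      (0 < V - rz)%N /\ (V - r <= 2 * (V - rz))%N].
Proof.
have := expn_gt0 2 J; rewrite /=; move: (2 ^ J)%N => m m0 h.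
by split; [lia|lia|move=> r0 rz h1 h2; lia].
Qed.

(** The point [x0] maximizes [|u x| * dist x ^ K], where [dist] is the distance
    to the boundary of the large box.  On a dyadic box around [x0] of radius
    between [dist x0 / 4] and [dist x0 / 2] the function [|u|] is then at most
    [2 ^ K * |u x0|], so that the bound at the centre improves from the mean of
    [|u| ^ (2 p')] to the mean of [|u|]; the power [K] absorbs the ratio of the sizes
    of the two boxes. *)
Lemma weighted_bound n (p q p' beta kap C : R) (V : nat)
    (omega : bond n.+2 -> R) (u : site n.+2 -> R) (y x0 : site n.+2) :
  let d : R := n.+2%:R in
  let K := d + beta * (d * (p^-1 + q^-1)) in
  let dist x := ((V - rad y x)%N)%:R : R in
  let L := Lambda p%:E q%:E omega (box y V) in
  0 < p -> 0 < q -> 0 < p' -> 1 < 2 * p' -> 0 < beta -> 2 * p' * kap = beta -> 0 < C ->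
  (forall e, 0 < omega e) ->
  (forall x, nabla_star (fun e => omega e * nabla u e) x = 0) ->
  (forall (u : site n.+2 -> R) (J : nat) (T A : R),
    (forall x, nabla_star (fun e => omega e * nabla u e) x = 0) ->
    (0 < J)%N -> 1 <= T -> 0 < A ->
    (\sum_(e <- bonds_in (box x0 (2 ^ J))) omega e `^ p) `^ p^-1 *
    (\sum_(e <- bonds_in (box x0 (2 ^ J))) (omega e)^-1 `^ q) `^ q^-1 <=
      T * 2 `^ (J%:R * (d * (p^-1 + q^-1))) ->
    \sum_(x <- box x0 (2 ^ J)) `|u x| `^ (2 * p') <=
      A `^ (2 * p') * 2 `^ (J%:R * d) -> u x0 <= C * T `^ kap * A) ->
  (0 < V)%N -> x0 \in box y V ->
  (forall z, z \in box y V -> `|u z| * dist z `^ K <= `|u x0| * dist x0 `^ K) ->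
  `|u x0| * dist x0 `^ K <=
  (C `^ (2 * p') * (2 `^ K) `^ (2 * p' - 1) + 1) * L `^ beta *
    site_norm 1%:E u (box y V) * (4 * (3 * d * V%:R)) `^ K.
Proof.
move=> d K dist L p0 q0 p'0 p'1 beta0 kapE C0 om0 hu center V0 x0V x0max.
have d1 : 1 <= d by rewrite /d ler1n.
have d0 : 0 < d := lt_le_trans ltr01 d1.
have a0 : 0 <= p^-1 + q^-1 by rewrite addr_ge0// invr_ge0 ltW.
have dK : d <= K by rewrite /K lerDl !mulr_ge0// ltW.
have K0 : 0 < K := lt_le_trans d0 dK.
have V1 : 1 <= V%:R :> R by rewrite ler1n.
pose W := 3 * d * V%:R : R.
have VW : 3 * V%:R <= W.
  by rewrite /W -mulrA; apply: ler_wpM2l => //; rewrite ler_peMl.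
have W1 : 1 <= W by apply: le_trans VW; lra.
have W0 : 0 < W := lt_le_trans ltr01 W1.
have bonds0 : (0 < #|` bonds_in (box y V)|)%N by exact: bonds_nonempty.
have L1 : 1 <= L by exact: Lambda_ge1.
have L0 : 0 < L := lt_le_trans ltr01 L1.
have Lb1 : 1 <= L `^ beta by rewrite powR_ge1// ltW.
rewrite site_norm1; set S1 := \sum_(x <- box y V) `|u x|.
set Bc : R := #|` box y V|%:R.
have Bc0 : 0 < Bc by rewrite /Bc card_box ltr0n expn_gt0.
have BcV : Bc <= (3 * V%:R) `^ d by exact: card_box_le.
have S10 : 0 <= S1 by exact: sumr_ge0.
have uS1 : `|u x0| <= S1 by rewrite /S1 (big_fsetD1 x0)//= lerDl; exact: sumr_ge0.
set avg := Bc^-1 * S1.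
have avg0 : 0 <= avg by rewrite mulr_ge0// invr_ge0 ltW.
have S1E : S1 = Bc * avg by rewrite /avg mulrA divff ?mul1r// lt0r_neq0.
set Cc := C `^ _ * _.
have Cc0 : 0 <= Cc by rewrite mulr_ge0 ?powR_ge0.
have [ux0|ux0] := eqVneq `|u x0| 0.
  rewrite ux0 mul0r.
  exact: mulr_ge0 (mulr_ge0 (mulr_ge0 (addr_ge0 Cc0 ler01) (powR_ge0 _ _)) avg0) (powR_ge0 _ _).
have ap : 0 < `|u x0| by rewrite lt0r ux0 normr_ge0.
pose D0 := (V - rad y x0)%N.
(* near the boundary the trivial bound by the sum over the box is enough *)
have [D4|D4] := leqP 4 D0; last first.
  have h1 : `|u x0| <= W `^ K * avg.
    apply: (le_trans uS1); rewrite S1E; apply: ler_wpM2r => //.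
    apply: (le_trans BcV); apply: (@le_trans _ _ (W `^ d)).
      by apply: ler_powRl; rewrite ?mulr_ge0 ?(ltW d0).
    exact: ler_powR.
  have h2 : dist x0 `^ K <= 4 `^ K.
    by apply: (ler_powRl (ltW K0)); rewrite ?ler0n// ler_nat ltnW.
  apply: (le_trans (ler_pM (normr_ge0 _) (powR_ge0 _ _) h1 h2)).
  have -> : (4 * W) `^ K = 4 `^ K * W `^ K by rewrite powRM// ltW.
  have h3 : 1 <= (Cc + 1) * L `^ beta by apply: mulr_ege1 => //; rewrite lerDr.
  have := ler_wpM2r (mulr_ge0 (mulr_ge0 (powR_ge0 W K) avg0) (powR_ge0 4 K)) h3.
  by rewrite mul1r => /le_trans; apply; rewrite le_eqVlt; apply/orP; left; apply/eqP; ring.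
have [J [J0 J1 J2]] := dyadic_radius D4.
have [rV mV radz] := dyadic_radius_facts J1.
set m : R := 2 `^ J%:R.
have mE : (2 ^ J)%:R = m by rewrite natrX /m powR_mulrn.
have m0 : 0 < m by exact: powR_gt0.
have mJ (r : R) : 2 `^ (J%:R * r) = m `^ r by rewrite powRrM.
have mW : m <= W.
  apply: le_trans VW; rewrite -mE -natrM ler_nat.
  exact: mV.
have sub : {subset box x0 (2 ^ J) <= box y V}.
  move=> z; rewrite !mem_box => zJ; apply: leq_trans (rad_triangle y x0 z) _.
  by apply: leq_trans rV; rewrite leq_add2l.
have uG z : z \in box x0 (2 ^ J) -> `|u z| <= 2 `^ K * `|u x0|.
  move=> zJ; have zV := sub z zJ; have := x0max z zV.
  have zd : (0 < V - rad y z)%N /\ (D0 <= 2 * (V - rad y z))%N.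
    by rewrite mem_box in zJ; exact: radz (rad_triangle y x0 z) zJ.
  have dz0 : 0 < dist z by rewrite ltr0n; case: zd.
  have dzx : dist x0 <= 2 * dist z by rewrite -natrM ler_nat; case: zd.
  have h := ler_powRl (ltW K0) (ler0n _ _) dzx.
  rewrite powRM ?ler0n ?(ltW dz0)// in h.
  move=> /le_trans /(_ (ler_wpM2l (normr_ge0 _) h)).
  by rewrite mulrA ler_pM2r ?powR_gt0// mulrC.
(* the averages over the small box exceed those over the large one by at most
   the ratio of their volumes *)
pose T := L * (W / m) `^ (d * (p^-1 + q^-1)).
have Wm1 : 1 <= W / m by rewrite ler_pdivlMr// mul1r.
have Wm0 : 0 < W / m := lt_le_trans ltr01 Wm1.
have T1 : 1 <= T by rewrite mulr_ege1// powR_ge1// mulr_ge0// ltW.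
have T0 : 0 < T := lt_le_trans ltr01 T1.
have hT : (\sum_(e <- bonds_in (box x0 (2 ^ J))) omega e `^ p) `^ p^-1 *
    (\sum_(e <- bonds_in (box x0 (2 ^ J))) (omega e)^-1 `^ q) `^ q^-1 <=
      T * 2 `^ (J%:R * (d * (p^-1 + q^-1))).
  apply: (le_trans (sums_Lambda_le p0 q0 om0 bonds0 sub)).
  rewrite mJ /T -mulrA -powRM ?(ltW Wm0) ?(ltW m0)// divfK ?lt0r_neq0//.
  apply: (ler_wpM2l (ltW L0)).
  rewrite [W `^ _]powRrM; apply: (ler_powRl a0).
    by rewrite mulr_ge0 ?ler0n.
  rewrite /W [3 * d]mulrC -mulrA powRM ?(ltW d0) ?mulr_ge0//.
  apply: ler_pM => //; rewrite ?ler0n//.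
  exact: le1r_powR.
have S1p : 0 < S1 := lt_le_trans ap uS1.
have subsum : \sum_(x <- box x0 (2 ^ J)) `|u x| <= S1.
  by apply: ler_fsum => // x xJ _ _; rewrite andbT sub.
have G0 : 0 < 2 `^ K :> R by exact: powR_gt0.
have key := center_bound_mean (fun u A hu A0 hA => center u J T A hu J0 T1 A0 hT hA)
  C0 (ltW T0) G0 S1p p'1 hu ap uG subsum.
rewrite kapE mJ in key.
have D0m : dist x0 <= 4 * m by rewrite -mE -natrM ler_nat.
have Dk : dist x0 `^ K <= (4 * m) `^ K by apply: (ler_powRl (ltW K0)); rewrite ?ler0n.
have S1m : S1 / m `^ d <= (W / m) `^ d * avg.
  rewrite S1E powR_div ?(ltW W0) ?(ltW m0)// mulrAC.
  apply: ler_wpM2r => //; apply: ler_wpM2r; first by rewrite invr_ge0 powR_ge0.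
  apply: (le_trans BcV); apply: ler_powRl; rewrite ?mulr_ge0 ?(ltW d0)//.
have Tb : T `^ beta = L `^ beta * (W / m) `^ (beta * (d * (p^-1 + q^-1))).
  by rewrite /T powRM ?powR_ge0 ?(ltW L0)// -powRrM [_ * beta]mulrC.
have WK : (W / m) `^ (beta * (d * (p^-1 + q^-1))) * (W / m) `^ d = (W / m) `^ K.
  by rewrite -powRD ?(gt_eqF Wm0) ?implybT// addrC.
have h1 : `|u x0| <= Cc * L `^ beta * avg * (W / m) `^ K.
  apply: (le_trans key); rewrite Tb -WK.
  set X := C `^ _; set Y := _ `^ (2 * p' - 1); set Z := L `^ _.
  set P := (W / m) `^ (beta * _); set Q := (W / m) `^ d in S1m *.
  have Q0 : 0 <= X * (Z * P) * Y by rewrite !mulr_ge0 ?powR_ge0.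
  have := ler_wpM2l Q0 S1m => /le_trans; apply.
  by rewrite /Cc -/X -/Y le_eqVlt; apply/orP; left; apply/eqP; ring.
apply: (le_trans (ler_pM (normr_ge0 _) (powR_ge0 _ _) h1 Dk)).
have E : (W / m) `^ K * (4 * m) `^ K = (4 * W) `^ K.
  have -> : 4 * W = W / m * (4 * m) by rewrite [RHS]mulrCA divfK// lt0r_neq0.
  by rewrite [RHS]powRM ?(ltW Wm0)// mulr_ge0// ltW.
rewrite -[X in X <= _]mulrA E -/W; apply: ler_wpM2r; first exact: powR_ge0.
apply: ler_wpM2r => //; apply: ler_wpM2r; first exact: powR_ge0.
by rewrite lerDl.
Qed.

(** Since [(2 * p')^-1 - s^-1 = dl], the positivity of [dl] is the inequality
    [2 * p' < s], and [gain / (gain - 1)] is [(2 * p' * dl)^-1]. *)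
Lemma iteration_exponents n (p q : R) : (0 < n)%N -> 1 < p -> 1 < q ->
  let dl := n.+1%:R^-1 - p^-1 / 2 - q^-1 / 2 in 0 < dl ->
  let p' := p / (p - 1) in
  exists s t : R, [/\ t^-1 = (1 + q^-1) / 2, 1 < t, 0 < s &
    [/\ s^-1 = t^-1 - n.+1%:R^-1, 2 * p' < s &
      2 * p' * (gain p' s / (2 * (gain p' s - 1))) = (2 * dl)^-1]].
Proof.
move=> n0 p1 q1 dl dl0 p'.
have p0 : 0 < p := lt_trans ltr01 p1; have q0 : 0 < q := lt_trans ltr01 q1.
have p'0 : 0 < p' by rewrite divr_gt0// subr_gt0.
have iq0 : 0 < q^-1 by rewrite invr_gt0.
have iq1 : q^-1 < 1 by rewrite invf_lt1.
have N2 : n.+1%:R^-1 <= 2^-1 :> R by rewrite lef_pV2 ?posrE ?ltr0n// ler_nat.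
set N := n.+1%:R^-1 in dl dl0 N2 *; clearbody N.
pose t : R := ((1 + q^-1) / 2)^-1; pose s : R := ((1 + q^-1) / 2 - N)^-1.
have tE : t^-1 = (1 + q^-1) / 2 by rewrite /t invrK.
have sE : s^-1 = (1 + q^-1) / 2 - N by rewrite /s invrK.
have p'E : (2 * p')^-1 = s^-1 + dl.
  by rewrite sE /p' /dl; field; lra.
have s0 : 0 < s by rewrite -invr_gt0 sE; lra.
have t0 : 0 < t by rewrite -invr_gt0 tE; lra.
clearbody p' s t dl.
have ps : 2 * p' < s.
  have h : s^-1 < (2 * p')^-1 by rewrite p'E ltrDl.
  have p2 : 0 < 2 * p' by exact: mulr_gt0.
  by move: h; rewrite ltf_pV2.
exists s, t; split => //; first by rewrite -invf_lt1 ?tE//; lra.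
split => //; first by rewrite tE.
have dE : dl = (2 * p')^-1 - s^-1 by rewrite p'E; ring.
by rewrite dE /gain; clear -p'0 s0 ps; field; rewrite !lt0r_neq0//; lra.
Qed.

(** For finite exponents the theorem holds with the smaller power [(2 * dl)^-1]:
    every [x] in the small box has distance at least [N] to the boundary of the
    large one, so the weighted bound at the maximum point applies to it. *)
Lemma local_boundedness n (p q : R) : (0 < n)%N -> 1 < p -> 1 < q ->
  let dl := n.+1%:R^-1 - p^-1 / 2 - q^-1 / 2 in 0 < dl ->
  exists C : R, 0 < C /\
  forall (omega : bond n.+2 -> R) (u : site n.+2 -> R),
  (forall e, 0 < omega e) ->
  (forall x, nabla_star (fun e => omega e * nabla u e) x = 0) ->
  forall (y : site n.+2) N, (0 < N)%N -> forall x, x \in box y N ->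
  `|u x| <= C * Lambda p%:E q%:E omega (box y (2 * N)) `^ (2 * dl)^-1 *
    site_norm 1%:E u (box y (2 * N)).
Proof.
move=> n0 p1 q1 dl dl0.
have p0 : 0 < p := lt_trans ltr01 p1; have q0 : 0 < q := lt_trans ltr01 q1.
have [s [t [tE t1 s0 [st sp kapE]]]] := iteration_exponents n0 p1 q1 dl0.
set p' := p / (p - 1) in sp kapE; set kap := gain p' s / _ in kapE.
set beta := (2 * dl)^-1 in kapE *.
have pm0 : 0 < p - 1 by rewrite subr_gt0.
have p'0 : 0 < p' by rewrite divr_gt0.
have pp' : p^-1 + p'^-1 = 1 by rewrite /p'; field; rewrite !lt0r_neq0.
have p'1 : 1 < 2 * p'.
  by rewrite /p' mulrA ltr_pdivlMr//; lra.
have beta0 : 0 < beta by rewrite invr_gt0 mulr_gt0.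
have [C [C0 center]] := center_bound n0 p0 p'0 pp' q0 tE t1 s0 st sp.
pose d : R := n.+2%:R; pose K := d + beta * (d * (p^-1 + q^-1)).
pose Cc := C `^ (2 * p') * (2 `^ K) `^ (2 * p' - 1) + 1.
have Cc0 : 0 < Cc by rewrite ltr_wpDl ?mulr_ge0 ?powR_ge0.
have d0 : 0 < d by rewrite ltr0n.
have K0 : 0 < K.
  have pq0 : 0 < p^-1 + q^-1 by rewrite addr_gt0// invr_gt0.
  exact: addr_gt0 d0 (mulr_gt0 beta0 (mulr_gt0 d0 pq0)).
have d24 : 0 < 24 * d by rewrite mulr_gt0.
exists (Cc * (24 * d) `^ K); split; first by rewrite mulr_gt0 ?powR_gt0.
move=> omega u om0 hu y N N0 x xN; set V := (2 * N)%N.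
have V0 : (0 < V)%N by rewrite muln_gt0.
pose dist (z : site n.+2) := ((V - rad y z)%N)%:R : R.
have NV : (N <= V)%N by rewrite leq_pmull.
have xV : x \in box y V by move: xN; rewrite !mem_box => /leq_trans; apply.
have boxn : (box y V : seq (site n.+2)) != [::].
  by apply/eqP => e; move: xV; rewrite [_ \in _]/(x \in (box y V : seq _)) e.
have [x0 x0V x0max] := seq_argmax (fun z => `|u z| * dist z `^ K) boxn.
have key := weighted_bound p0 q0 p'0 p'1 beta0 kapE C0 om0 hu
  (fun u J T A hu => center omega u x0 J T A om0 hu) V0 x0V x0max.
have xd : N%:R `^ K <= dist x `^ K.
  apply: (ler_powRl (ltW K0)); first exact: ler0n.
  rewrite mem_box in xN; rewrite ler_nat /V mul2n -addnn -addnBA//.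
  exact: leq_addr.
have NK : 0 < N%:R `^ K :> R by rewrite powR_gt0// ltr0n.
rewrite -(ler_pM2r NK).
apply: (le_trans (ler_wpM2l (normr_ge0 _) xd)).
apply: (le_trans (x0max x xV)); apply: (le_trans key).
have -> : (4 * (3 * n.+2%:R * V%:R)) `^ K = (24 * d) `^ K * N%:R `^ K.
  rewrite -powRM ?ler0n ?(ltW d24)//; congr (_ `^ _).
  by rewrite /V natrM /d; ring.
rewrite -/d -/K -/Cc le_eqVlt; apply/orP; left; apply/eqP; ring.
Qed.

(** An exponent [+oo] may be replaced by a large finite one: averages are at most
    suprema, and the reciprocal exponent changes by at most [eps]. *)
Lemma finite_exponent_exists (p : \bar R) (eps : R) : (1 < p)%E -> 0 < eps < 1 ->
  exists r : R, [/\ 1 < r, r^-1 <= recip p + eps &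
    forall (K : choiceType) (f : K -> R) (S : {fset K}), (0 < #|` S|)%N ->
      avg_norm r%:E f S <= avg_norm p f S].
Proof.
case: p => [r| |] //= p1 /andP[eps0 eps1].
  rewrite lte_fin in p1; exists r; split => //.
  by rewrite /recip inver gt_eqF ?(lt_trans ltr01 p1)//= lerDl ltW.
exists eps^-1; split; first by rewrite invf_gt1.
  by rewrite invrK /recip invey/= add0r.
move=> K f S S0; rewrite /avg_norm invrK.
set M := \big[Num.max/0]_(a <- S) `|f a|.
have M0 : 0 <= M by exact: bigmax_ge_id.
have fM a : a \in S -> `|f a| <= M by move=> aS; exact: (@le_bigmax_seq _ _ _ _ _ a xpredT (fun a => `|f a|) aS isT).
have eV0 : 0 <= eps^-1 by rewrite invr_ge0 ltW.
have N0 : 0 < #|` S|%:R :> R by rewrite ltr0n.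
have h : (#|` S|%:R)^-1 * (\sum_(a <- S) `|f a| `^ eps^-1) <= M `^ eps^-1.
  rewrite ler_pdivrMl//.
  apply: (@le_trans _ _ (\sum_(a <- S) M `^ eps^-1)).
    rewrite big_seq [X in _ <= X]big_seq; apply: ler_sum => a aS.
    by apply: (ler_powRl eV0); [exact: normr_ge0|exact: fM].
  by rewrite big_const_seq count_predT iter_addr_0 -[M `^ _ *+ _]mulr_natl.
apply: (le_trans (ler_powRl (ltW eps0) _ h)).
  by rewrite mulr_ge0 ?invr_ge0 ?ler0n// sumr_ge0// => a _; exact: powR_ge0.
by rewrite powRVK// lt0r_neq0.
Qed.

Lemma dual_exp_ge1 (p : \bar R) : (1 < p)%E -> 1 <= dual_exp p.
Proof.
case: p => [r| |] //=; rewrite lte_fin => r1.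
by rewrite ler_pdivlMr ?subr_gt0// mul1r lerBlDr lerDl.
Qed.

Lemma avg_norm_ge0 (K : choiceType) (p : \bar R) (f : K -> R) (S : {fset K}) :
  0 <= avg_norm p f S.
Proof. by case: p => [r| |] //=; [exact: powR_ge0|exact: bigmax_ge_id]. Qed.

End MeanBound.

Theorem theorem2 (R : realType) (d : nat) (p q : \bar R) :
  (3 <= d)%N ->
  (1 < p)%E -> (1 < q)%E ->
  recip p + recip q < 2 / (d%:R - 1) ->
  0 < delta d p q /\
  exists c : R, 1 <= c /\
    forall omega : bond d -> R, (forall e, 0 < omega e) ->
    forall u : site d -> R,
      (forall x, nabla_star (fun e => omega e * nabla u e) x = 0) ->
    forall (y : site d) (n : nat), (1 <= n)%N ->
      \big[Num.max/0]_(x <- box y n) `|u x| <=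
        c * Lambda p q omega (box y (2 * n))
              `^ (dual_exp p * ((delta d p q + 1) / delta d p q))
          * site_norm 1%:E u (box y (2 * n)).
Proof.
move=> d3 p1 q1 pq.
case: d d3 pq => [|[|n]] // n0 pq; rewrite ltnS ltnS in n0.
have dE : n.+2%:R - 1 = n.+1%:R :> R by rewrite -natr1 addrK.
have n1 : 0 < n.+1%:R :> R by rewrite ltr0n.
have dl0 : 0 < delta n.+2 p q by move: pq; rewrite /delta; lra.
split => //; set dl := delta n.+2 p q in dl0 *.
have rp0 : 0 <= recip p by apply: fine_ge0; rewrite inve_ge0 ltW// (lt_trans _ p1).
have rq0 : 0 <= recip q by apply: fine_ge0; rewrite inve_ge0 ltW// (lt_trans _ q1).
have N2 : n.+1%:R^-1 <= 2^-1 :> R by rewrite lef_pV2 ?posrE ?ltr0n// ler_nat.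
(* two changes of a reciprocal exponent by [dl / 2] cost half of [dl] *)
have eps01 : 0 < dl / 2 < 1.
  by move: dl0; rewrite /dl /delta dE; move: N2; set N := n.+1%:R^-1 => N2 dl0; lra.
have [r [r1 rp rS]] := finite_exponent_exists p1 eps01.
have [t [t1 tq tS]] := finite_exponent_exists q1 eps01.
have dl'_ge : dl / 2 <= n.+1%:R^-1 - r^-1 / 2 - t^-1 / 2.
  by move: rp tq; rewrite /dl /delta dE; move: (n.+1%:R^-1) (r^-1) (t^-1) => N r' t'; lra.
have dl2 : 0 < dl / 2 by rewrite divr_gt0.
have dl'0 := lt_le_trans dl2 dl'_ge.
have [C [C0 CP]] := local_boundedness n0 r1 t1 dl'0.
exists (C + 1); split; first by rewrite lerDr ltW.
move=> omega om0 u hu y N N0.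
set B := box y (2 * N); set P := dual_exp p * _.
have r0 : 0 < r := lt_trans ltr01 r1; have t0 : 0 < t := lt_trans ltr01 t1.
have bonds0 : (0 < #|` bonds_in B|)%N by apply: bonds_nonempty => //; rewrite muln_gt0.
have L1 : 1 <= Lambda r%:E t%:E omega B by exact: Lambda_ge1.
have LL : Lambda r%:E t%:E omega B <= Lambda p q omega B.
  by apply: ler_pM (avg_norm_ge0 _ _ _) (avg_norm_ge0 _ _ _) (rS _ _ _ bonds0) (tS _ _ _ bonds0).
have avg0 : 0 <= site_norm 1%:E u B by exact: avg_norm_ge0.
set beta := (2 * _)^-1 in CP.
have beta0 : 0 <= beta by rewrite invr_ge0 mulr_ge0// ltW.
have betaP : beta <= P.
  apply: (@le_trans _ _ dl^-1).
    rewrite lef_pV2 ?posrE// ?mulr_gt0//.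
    by rewrite -ler_pdivrMl// mulrC.
  rewrite /P mulrDl divff ?lt0r_neq0// mul1r.
  have dV0 : 0 <= dl^-1 by rewrite invr_ge0 ltW.
  have := ler_wpM2r (addr_ge0 ler01 dV0) (dual_exp_ge1 p1).
  by rewrite mul1r; apply: le_trans; rewrite lerDr.
have LP : Lambda r%:E t%:E omega B `^ beta <= Lambda p q omega B `^ P.
  have L1' := le_trans L1 LL.
  apply: le_trans (ler_powR L1' betaP).
  by apply: (ler_powRl beta0 (le_trans ler01 L1)).
have H x : x \in box y N -> `|u x| <= (C + 1) * Lambda p q omega B `^ P * site_norm 1%:E u B.
  move=> xN; apply: (le_trans (CP omega u om0 hu y N N0 x xN)).
  apply: ler_wpM2r => //; apply: ler_pM LP; rewrite ?powR_ge0 ?(ltW C0)//.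
  by rewrite lerDl.
rewrite big_seq; apply: bigmax_le => [|x xN]; last exact: H.
by rewrite !mulr_ge0 ?powR_ge0// addr_ge0// ltW.
Qed.
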